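(* Let $\Sigma$ be a smooth projective fan in $N_{\mathbb{R}}$, $n=\dim N_{\mathbb{R}}$, and let $\mathcal{E}$ be a rank $r$ tropical vector bundle on $X_\Sigma$ with filtrations $(F^\rho_i)$ and multiset of characters $u(\tau)=\{u_{\tau,1},\dots,u_{\tau,r}\}$ on each cone $\tau\in\Sigma$. Let $f:|\Sigma|\to\mathbb{R}$ be an integral piecewise linear function, linear on each cone of $\Sigma$, such that $F^\rho_i$ has rank $0$ whenever $i>f(\mathbf{v}_\rho)$. For $\sigma,\tau\in\Sigma$ let $u^\sigma(\tau)=\{u^\sigma_{\tau,1},\dots,u^\sigma_{\tau,r}\}$ be the multiset of characters defined by $$\langle u^\sigma_{\tau,j},\mathbf{v}_\rho\rangle=\begin{cases}f(\mathbf{v}_\rho)&\text{if }\rho\in\tau(1)\setminus\sigma(1),\\ \langle u_{\sigma,j},\mathbf{v}_\rho\rangle&\text{if }\rho\in\tau(1)\cap\sigma(1),\end{cases}$$ and let $\mathcal{F}_0,\dots,\mathcal{F}_n$ be the tropical vector bundles defined in the context. Then for every $\tau\in\Sigma$ and $x\in\tau$, $$K_{\mathcal{E}}(x)=\sum_{\sigma\in\Sigma}(-1)^{\operatorname{codim}(\sigma)}\sum_{j=1}^r\exp(\langle u^\sigma_{\tau,j},x\rangle)=\sum_{k=0}^n(-1)^kK_{\mathcal{F}_k}(x).$$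
   Context: Let $N\cong\mathbb{Z}^n$ be a lattice with dual lattice $M$ (the character lattice), pairing $\langle\cdot,\cdot\rangle$, and $N_{\mathbb{R}}=N\otimes\mathbb{R}$. Cones of fans are strictly convex rational polyhedral; smooth means that the primitive ray generators of each cone form part of a $\mathbb{Z}$-basis of $N$; a projective fan is complete. $\Sigma(1)$ is the set of rays, $\sigma(1)$ the set of rays of a cone $\sigma$, $\mathbf{v}_\rho\in N$ the primitive generator of $\rho$, $\operatorname{codim}(\sigma)=n-\dim\sigma$. Tropical vector bundle. A tropical vector bundle $\mathcal{E}$ of rank $r$ over $X_\Sigma$ consists of a matroid $\mathcal{M}$ of rank $r$ on a finite ground set $\mathcal{G}$ and, for each $\rho\in\Sigma(1)$, a decreasing filtration $(F^\rho_i)_{i\in\mathbb{Z}}$ by flats of $\mathcal{M}$, such that for each $\sigma\in\Sigma$ there are a basis $B_\sigma=\{b_{\sigma,1},\dots,b_{\sigma,r}\}$ of $\mathcal{M}$ and a multiset of characters $u(\sigma)=\{u_{\sigma,1},\dots,u_{\sigma,r}\}\subset M$ with $F^\rho_i=\operatorname{span}\{b_{\sigma,j}\mid\langle u_{\sigma,j},\mathbf{v}_\rho\rangle\ge i\}$ for all $\rho\in\sigma(1)$, $i\in\mathbb{Z}$. Here $\operatorname{span}$ is matroid closure. Choices of $B_\sigma$ and $u(\sigma)$ are fixed. Equivariant $K$-class. $K_{\mathcal{E}}:|\Sigma|\to\mathbb{R}$ is the (well-defined) function $K_{\mathcal{E}}(x)=\sum_{i=1}^r\exp(\langle u_{\tau,i},x\rangle)$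 for $x\in\tau\in\Sigma$. The characters $u^\sigma_{\tau,j}$ exist because $\Sigma$ is smooth, and their restrictions to $\tau$ are uniquely determined. The bundles $\mathcal{F}_k$. For $0\le k\le n$, $\mathcal{F}_k$ is the tropical vector bundle whose matroid is the direct sum of copies of $\mathcal{M}$ indexed by the cones $\sigma\in\Sigma$ with $\operatorname{codim}(\sigma)=k$, with filtrations $G^\rho_i=\bigoplus_{\operatorname{codim}(\sigma)=k}G^\rho_{\sigma,i}$, where $G^\rho_{\sigma,i}=F^\rho_i$ if $\rho\in\sigma(1)$; $G^\rho_{\sigma,i}=\mathcal{G}$ if $\rho\notin\sigma(1)$ and $f(\mathbf{v}_\rho)\ge i$; and $G^\rho_{\sigma,i}=\operatorname{span}(\emptyset)$ (the rank $0$ flat) if $\rho\notin\sigma(1)$ and $f(\mathbf{v}_\rho)<i$. Its multiset of characters on $\tau\in\Sigma$ is $\bigsqcup_{\operatorname{codim}(\sigma)=k}u^\sigma(\tau)$, so $K_{\mathcal{F}_k}(x)=\sum_{\operatorname{codim}(\sigma)=k}\sum_{j=1}^r\exp(\langle u^\sigma_{\tau,j},x\rangle)$ for $x\in\tau$. *)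

(* Defs.v *)
From HB Require Import structures.
(* boolp, classical_sets first: set0, setT, subsetP, etc. refer to finite
   sets. *)
From mathcomp Require Import boolp classical_sets reals sequences exp.
From mathcomp Require Import all_boot all_order all_algebra.

Set Implicit Arguments.
Unset Strict Implicit.
Unset Printing Implicit Defensive.

Import Order.TTheory GRing.Theory Num.Theory.
Local Open Scope ring_scope.

(* The lattice N = Z^n and its dual M are both 'rV[int]_n, and the duality
   pairing is the standard one; N_R and M_R are 'rV[R]_n, with R the field of
   real numbers. *)

Definition pairing (A : pzRingType) (n : nat) (u v : 'rV[A]_n) : A :=
  \sum_i u 0 i * v 0 i.

Definition lat (R : realType) (n : nat) (v : 'rV[int]_n) : 'rV[R]_n :=
  map_mx intr v.
Arguments lat R {n} v.

Definition primitive (n : nat) (v : 'rV[int]_n) : Prop :=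
  forall (d : int) (w : 'rV[int]_n), v = d *: w -> `|d| = 1.

Section Cones.
Variables (R : realType) (n : nat).
Implicit Types (C F : set 'rV[R]_n).

Definition conic (s : seq 'rV[R]_n) : set 'rV[R]_n :=
  [set x | exists c : 'I_(size s) -> R,
     (forall i, 0 <= c i) /\ x = \sum_i c i *: s`_i]%classic.

Definition rational_polyhedral C : Prop :=
  exists s : seq 'rV[int]_n, C = conic [seq lat R v | v <- s].

Definition strictly_convex C : Prop :=
  forall x, C x -> C (- x) -> x = 0.

Definition is_face F C : Prop :=
  exists w : 'rV[R]_n, (forall x, C x -> 0 <= pairing w x) /\
    F = (C `&` [set x | pairing w x = 0])%classic.

Definition lin_span C : {vspace 'rV[R]_n} :=
  xget fullv [set V : {vspace 'rV[R]_n} |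
    (forall x, C x -> x \in V) /\
    (forall W : {vspace 'rV[R]_n}, (forall x, C x -> x \in W) ->
       (V <= W)%VS)]%classic.

Definition cone_dim C : nat := \dim (lin_span C).

End Cones.

(* The underlying finite type indexes the cones of the fan without
   repetition. *)
Record fan (R : realType) (n : nat) := Fan {
  cone :> finType;
  carrier : cone -> set 'rV[R]_n;
  carrier_inj : injective carrier;
  carrier_rational : forall s, rational_polyhedral (carrier s);
  carrier_strict : forall s, strictly_convex (carrier s);
  carrier_face : forall s F, is_face F (carrier s) ->
    exists t, carrier t = F;
  carrier_inter : forall s t,
    is_face (carrier s `&` carrier t)%classic (carrier s) /\
    is_face (carrier s `&` carrier t)%classic (carrier t)
}.

Section Fans.
Variables (R : realType) (n : nat) (S : fan R n).

Definition support : set 'rV[R]_n :=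
  [set x | exists s : S, carrier s x]%classic.

Definition codim (s : S) : nat := (n - cone_dim (carrier s))%N.

Definition ray : finType := {s : S | cone_dim (carrier s) == 1%N}.

Definition rays (s : S) : {set ray} :=
  [set p : ray | `[< is_face (carrier (val p)) (carrier s) >]].

Definition prim_gen (p : ray) : 'rV[int]_n :=
  xget 0 [set v : 'rV[int]_n |
    primitive v /\ carrier (val p) = conic [:: lat R v]]%classic.

(* The Z-bases of Z^n are the sets of rows of the matrices invertible over
   the integers. *)
Definition smooth : Prop :=
  forall s : S, exists2 A : 'M[int]_n, A \in unitmx &
    forall p, p \in rays s -> exists i, row i A = prim_gen p.

Definition minimizes (P : seq 'rV[int]_n) (w : 'rV[R]_n) (m : 'rV[int]_n) :
    Prop :=
  m \in P /\
  forall m', m' \in P -> pairing (lat R m) w <= pairing (lat R m') w.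

(* The cone of all x such that <-, x> is minimal along the whole face of the
   polytope conv P on which <-, w> is minimal. *)
Definition normal_cone (P : seq 'rV[int]_n) (w : 'rV[R]_n) :
    set 'rV[R]_n :=
  [set x | forall m, minimizes P w m -> minimizes P x m]%classic.

(* X_S is projective when S is the inner normal fan of a lattice polytope
   conv P. The polytope is full-dimensional because the cones of S are
   strictly convex, and S is complete because x lies in normal_cone P x. *)
Definition projective : Prop :=
  exists2 P : seq 'rV[int]_n, P != [::] &
    forall C : set 'rV[R]_n,
      (exists s : S, carrier s = C) <-> (exists w, C = normal_cone P w).

(* Only the values of f on the support of S are relevant. *)
Definition integral_pl (f : 'rV[R]_n -> R) : Prop :=
  (forall s : S, exists w : 'rV[R]_n,
     forall x, carrier s x -> f x = pairing w x) /\
  (forall v : 'rV[int]_n, support (lat R v) -> f (lat R v) \is a Num.int).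

End Fans.

Record matroid (G : finType) := Matroid {
  indep : pred {set G};
  indep0 : indep set0;
  indepS : forall A B : {set G}, A \subset B -> indep B -> indep A;
  indep_aug : forall A B : {set G}, indep A -> indep B -> (#|A| < #|B|)%N ->
    exists2 x, x \in B :\: A & indep (x |: A)
}.

Section MatroidTheory.
Variables (G : finType) (M : matroid G).
Implicit Types (A B : {set G}).

Definition mrank A : nat :=
  (\max_(B : {set G} | indep M B && (B \subset A)) #|B|)%N.

Definition mspan A : {set G} := [set x | mrank (x |: A) == mrank A].

Definition flat A : bool := mspan A == A.

Definition is_basis B : bool := maxset (indep M) B.

Lemma mrank_witness A :
  exists B, [/\ indep M B, B \subset A & mrank A = #|B|].
Proof.
have P0 : indep M set0 && (set0 \subset A) by rewrite indep0 sub0set.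
rewrite /mrank (bigop.bigmax_eq_arg set0) //.
by case: arg_maxnP => //= B /andP[iB sB] _; exists B.
Qed.

Lemma card_indep_le A B : indep M B -> B \subset A -> (#|B| <= mrank A)%N.
Proof.
move=> iB sB; have P : indep M B && (B \subset A) by rewrite iB.
exact: (@bigop.leq_bigmax_cond _ _ (fun X : {set G} => #|X|) B P).
Qed.

Lemma mrankS A B : A \subset B -> (mrank A <= mrank B)%N.
Proof.
move=> sAB; have [C [iC sC ->]] := mrank_witness A.
by apply: card_indep_le => //; exact: subset_trans sAB.
Qed.

Lemma mspanT : mspan setT = setT.
Proof. by apply/setP=> x; rewrite !inE setUT eqxx. Qed.

Lemma mrank0 : mrank set0 = 0%N.
Proof.
have [B [_ sB ->]] := mrank_witness set0.
by move: sB; rewrite subset0 => /eqP ->; rewrite cards0.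
Qed.

Lemma mrank_span0 : mrank (mspan set0) = 0%N.
Proof.
have [B [iB sB ->]] := mrank_witness (mspan set0).
apply/eqP; rewrite cards_eq0; apply/set0Pn=> -[x xB].
have := subsetP sB _ xB; rewrite inE setU0 mrank0 => /eqP r0.
have: (#|[set x]| <= mrank [set x])%N.
  by apply: card_indep_le => //; apply: indepS iB; rewrite sub1set.
by rewrite cards1 r0.
Qed.

Lemma flat_span0 : flat (mspan set0).
Proof.
apply/eqP/setP=> x; rewrite [RHS]inE [LHS]inE mrank_span0 setU0 mrank0.
apply/eqP/eqP=> [r0|rx].
  apply/eqP; rewrite -leqn0 -[leqRHS]r0; apply: mrankS; exact: subsetUl.
have xs : x \in mspan set0 by rewrite inE setU0 mrank0 rx.
by rewrite (setUidPr _) ?mrank_span0 // sub1set.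
Qed.

Lemma flatT : flat setT.
Proof. by rewrite /flat mspanT. Qed.

Lemma card_basis B : is_basis B -> #|B| = mrank setT.
Proof.
move=> bB; have iB := maxsetp bB.
apply/eqP; rewrite eqn_leq card_indep_le ?subsetT //= leqNgt; apply/negP.
have [C [iC _ ->]] := mrank_witness setT.
move=> /(indep_aug iB iC)[x /setDP[_ xNB] iU].
have := maxsetsup bB iU (subsetUr _ _) => /setP/(_ x).
by rewrite !inE eqxx (negPf xNB).
Qed.

Lemma mspan_basis B : is_basis B -> mspan B = setT.
Proof.
move=> bB; apply/setP=> x; rewrite !inE eqn_leq [X in _ && X]mrankS ?subsetUr //.
rewrite andbT (leq_trans (mrankS (subsetT _))) // -(card_basis bB).
exact: card_indep_le (maxsetp bB) _.
Qed.

End MatroidTheory.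

Lemma eq_imset_pred (T T' : finType) (h : T -> T') (P Q : pred T) :
  P =1 Q -> [set h x | x : T & P x] = [set h x | x : T & Q x].
Proof.
move=> PQ; apply/setP=> y.
by apply/imsetP/imsetP=> -[x xP ->]; exists x => //; move: xP; rewrite !inE PQ.
Qed.

Lemma imset_predT (T T' : finType) (h : T -> T') :
  [set h x | x : T & xpredT x] = [set h x | x : T].
Proof.
by apply/setP=> y; apply/imsetP/imsetP=> -[x _ ->]; exists x; rewrite ?inE.
Qed.

Section DirectSum.
Variables (I G : finType).
Implicit Types (A B : {set I * G}).

Definition slice (A : {set I * G}) (i : I) : {set G} :=
  [set g | (i, g) \in A].

Definition dsum_indep (M : matroid G) : pred {set I * G} :=
  fun A => [forall i, indep M (slice A i)].

Lemma card_slice (A : {set I * G}) : #|A| = (\sum_i #|slice A i|)%N.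
Proof.
rewrite -sum1_card (eq_bigl (fun p : I * G => true && (p.2 \in slice A p.1)));
  last by case=> i g; rewrite inE.
rewrite -(pair_big_dep xpredT (fun i g => g \in slice A i) (fun _ _ => 1%N)) /=.
by apply: eq_bigr => i _; rewrite sum1_card.
Qed.

Lemma sliceS (A B : {set I * G}) i : A \subset B -> slice A i \subset slice B i.
Proof. by move=> /subsetP sAB; apply/subsetP=> g; rewrite !inE => /sAB. Qed.

Lemma dsum_indep0 (M : matroid G) : dsum_indep M set0.
Proof.
apply/forallP=> i; suff -> : slice set0 i = set0 by exact: indep0.
by apply/setP=> g; rewrite !inE.
Qed.

Lemma dsum_indepS (M : matroid G) A B :
  A \subset B -> dsum_indep M B -> dsum_indep M A.
Proof.
move=> sAB /forallP iB; apply/forallP=> i.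
exact: indepS (sliceS i sAB) (iB i).
Qed.

Lemma slice_add A (i j : I) (g : G) :
  slice ((i, g) |: A) j = if j == i then g |: slice A j else slice A j.
Proof.
by apply/setP=> h; case: eqP => [->|/eqP ji]; rewrite !inE xpair_eqE ?eqxx //
  (negPf ji).
Qed.

Lemma dsum_indep_aug (M : matroid G) A B :
  dsum_indep M A -> dsum_indep M B -> (#|A| < #|B|)%N ->
  exists2 x, x \in B :\: A & dsum_indep M (x |: A).
Proof.
move=> /forallP iA /forallP iB ltAB.
have [i lti] : exists i, (#|slice A i| < #|slice B i|)%N.
  apply/existsP; apply: contraLR ltAB => /existsPn nlt.
  by rewrite -leqNgt !card_slice leq_sum // => i _; rewrite leqNgt nlt.
have [g /setDP[gB gA] ig] := indep_aug (iA i) (iB i) lti.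
exists (i, g); first by move: gA gB; rewrite !inE => -> ->.
by apply/forallP=> j; rewrite slice_add; case: eqP => [->|].
Qed.

(* The direct sum of copies of M indexed by I. *)
Definition dsum (M : matroid G) : matroid (I * G)%type :=
  Matroid (dsum_indep0 M) (@dsum_indepS M) (@dsum_indep_aug M).

Definition glue (A : I -> {set G}) : {set I * G} :=
  [set p : I * G | p.2 \in A p.1].

Lemma slice_glue (A : I -> {set G}) i : slice (glue A) i = A i.
Proof. by apply/setP=> g; rewrite !inE. Qed.

Lemma mrank_dsum (M : matroid G) A :
  mrank (dsum M) A = (\sum_i mrank M (slice A i))%N.
Proof.
apply/eqP; rewrite eqn_leq; apply/andP; split.
  have [B [/forallP iB sB ->]] := mrank_witness (dsum M) A.
  rewrite card_slice leq_sum // => i _; exact: card_indep_le (sliceS i sB).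
have /fin_all_exists[B hB] i := mrank_witness M (slice A i).
rewrite (eq_bigr (fun i => #|slice (glue B) i|)); last first.
  by move=> i _; rewrite slice_glue; case: (hB i).
rewrite -card_slice; apply: card_indep_le.
  by apply/forallP=> i; rewrite slice_glue; case: (hB i).
apply/subsetP=> -[i g]; rewrite inE /= => gB; have [_ /subsetP s _] := hB i.
by have := s _ gB; rewrite inE.
Qed.

Lemma mspan_dsum (M : matroid G) A :
  mspan (dsum M) A = glue (fun i => mspan M (slice A i)).
Proof.
apply/setP=> -[i g]; rewrite !inE /= !mrank_dsum (bigD1 i) //=.
rewrite [X in _ == X](bigD1 i) //= slice_add eqxx.
rewrite [X in (_ + X)%N == _](eq_bigr (fun j => mrank M (slice A j))).
  by rewrite eqn_add2r.
by move=> j ji; rewrite slice_add (negPf ji).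
Qed.

Lemma flat_glue (M : matroid G) (A : I -> {set G}) :
  (forall i, flat M (A i)) -> flat (dsum M) (glue A).
Proof.
move=> fA; apply/eqP; rewrite mspan_dsum; apply/setP=> -[i g].
by rewrite [LHS]inE [RHS]inE /= slice_glue (eqP (fA i)).
Qed.

Lemma basis_glue (M : matroid G) (B : I -> {set G}) :
  (forall i, is_basis M (B i)) -> is_basis (dsum M) (glue B).
Proof.
move=> bB; apply/maxsetP; split.
  by apply/forallP=> i; rewrite slice_glue; exact: maxsetp (bB i).
move=> C /forallP iC sBC; apply/setP=> -[i g].
have sBi : B i \subset slice C i by rewrite -(slice_glue B); exact: sliceS.
by have /setP/(_ g) := maxsetsup (bB i) (iC i) sBi; rewrite !inE.
Qed.

End DirectSum.

(* The multiset of characters on a cone s is the family (tvb_char s j) indexed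
   by j < r, and tvb_char s j is paired with the basis element
   tvb_basis s j. *)
Record tvb (R : realType) (n : nat) (S : fan R n) (r : nat) := Tvb {
  ground : finType;
  tvb_matroid : matroid ground;
  tvb_rank : mrank tvb_matroid setT = r;
  filt : ray S -> int -> {set ground};
  filt_flat : forall p i, flat tvb_matroid (filt p i);
  filt_decr : forall p (i j : int), i <= j -> filt p j \subset filt p i;
  tvb_basis : S -> 'I_r -> ground;
  tvb_basis_inj : forall s, injective (tvb_basis s);
  tvb_basisP : forall s, is_basis tvb_matroid [set tvb_basis s j | j : 'I_r];
  tvb_char : S -> 'I_r -> 'rV[int]_n;
  filtE : forall (s : S) p (i : int), p \in rays s ->
    filt p i = mspan tvb_matroid
      [set tvb_basis s j |
         j : 'I_r & i <= pairing (tvb_char s j) (prim_gen p)]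
}.

(* The value at x is computed on an arbitrarily chosen cone containing x; it
   is 0 outside of the support of the fan. *)
Definition Kclass (R : realType) (n : nat) (S : fan R n) (r : nat)
    (E : tvb S r) (x : 'rV[R]_n) : R :=
  if [pick t : S | `[< carrier t x >]] is Some t
  then \sum_(j < r) expR (pairing (lat R (tvb_char E t j)) x)
  else 0.

Section Twist.
Variables (R : realType) (n : nat) (S : fan R n) (r : nat) (E : tvb S r).
Variable f : 'rV[R]_n -> R.

(* u s t j stands for the character u^s_{t,j}. Such u exist when S is smooth
   and f is integral, and each u s t j is determined on the cone t. *)
Definition twisted_chars (u : S -> S -> 'I_r -> 'rV[int]_n) : Prop :=
  forall (s t : S) (j : 'I_r) (p : ray S), p \in rays t ->
    (pairing (u s t j) (prim_gen p))%:~R =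
      if p \in rays s
      then (pairing (tvb_char E s j) (prim_gen p))%:~R
      else f (lat R (prim_gen p)).

Definition twisted_filt (s : S) (p : ray S) (i : int) : {set ground E} :=
  if p \in rays s then filt E p i
  else if i%:~R <= f (lat R (prim_gen p)) then setT
  else mspan (tvb_matroid E) set0.

Lemma twisted_filt_flat s p i : flat (tvb_matroid E) (twisted_filt s p i).
Proof.
rewrite /twisted_filt; case: ifP => _; first exact: filt_flat.
by case: ifP => _; [exact: flatT | exact: flat_span0].
Qed.

Lemma twisted_filt_decr s p (i j : int) : i <= j ->
  twisted_filt s p j \subset twisted_filt s p i.
Proof.
move=> ij; rewrite /twisted_filt; case: ifP => _; first exact: filt_decr.
case: ifP => [jf|_].
  by rewrite (le_trans _ jf) // ler_int.
case: ifP => _; [exact: subsetT | exact: subxx].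
Qed.

Lemma twisted_filtE u (s t : S) p (i : int) : twisted_chars u -> p \in rays t ->
  twisted_filt s p i = mspan (tvb_matroid E)
    [set tvb_basis E s j | j : 'I_r & i <= pairing (u s t j) (prim_gen p)].
Proof.
move=> hu pt; rewrite /twisted_filt; case: ifPn => ps.
  rewrite (filtE E i ps); congr mspan; apply: eq_imset_pred => j.
  by rewrite -!(ler_int R) (hu s t j p pt) ps.
have e j : (i <= pairing (u s t j) (prim_gen p)) =
           (i%:~R <= f (lat R (prim_gen p))).
  by rewrite -(ler_int R) (hu s t j p pt) (negPf ps).
case: ifPn => fi.
  rewrite -(mspan_basis (tvb_basisP E s)); congr mspan.
  by apply/setP=> g; apply/imsetP/imsetP=> -[j hj ->]; exists j;
    rewrite // inE e fi.
congr mspan; apply/esym/setP=> g; rewrite !inE; apply/negP=> /imsetP[j].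
by rewrite inE e (negPf fi).
Qed.

Variables (u : S -> S -> 'I_r -> 'rV[int]_n) (hu : twisted_chars u) (k : nat).

Let cones_k : finType := {s : S | codim s == k}.
Let Fk_rank_val := #|{: cones_k * 'I_r}|.

Let Fk_basis (t : S) (a : 'I_Fk_rank_val) : cones_k * ground E :=
  let p := enum_val a in (p.1, tvb_basis E (val p.1) p.2).

Let Fk_char (t : S) (a : 'I_Fk_rank_val) : 'rV[int]_n :=
  let p := enum_val a in u (val p.1) t p.2.

Let Fk_filt (p : ray S) (i : int) : {set cones_k * ground E} :=
  glue (fun s : cones_k => twisted_filt (val s) p i).

Let Fk_matroid := dsum cones_k (tvb_matroid E).

Lemma Fk_rank : mrank Fk_matroid setT = Fk_rank_val.
Proof.
rewrite mrank_dsum (eq_bigr (fun _ => r)).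
  by rewrite sum_nat_const /Fk_rank_val card_prod card_ord.
move=> s _; suff -> : slice [set: cones_k * ground E] s = setT.
  exact: tvb_rank.
by apply/setP=> g; rewrite !inE.
Qed.

Lemma Fk_flat p i : flat Fk_matroid (Fk_filt p i).
Proof. by apply: flat_glue => s; exact: twisted_filt_flat. Qed.

Lemma Fk_decr p (i j : int) : i <= j -> Fk_filt p j \subset Fk_filt p i.
Proof.
move=> ij; apply/subsetP=> -[s g]; rewrite !inE /=.
by apply: subsetP; exact: twisted_filt_decr.
Qed.

Lemma Fk_basis_inj t : injective (Fk_basis t).
Proof.
move=> a b; rewrite /Fk_basis => -[e1 e2]; apply: enum_val_inj.
move: e1 e2; case: (enum_val a) (enum_val b) => [s j] [s' j'] /= <-.
by move=> /tvb_basis_inj ->.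
Qed.

Lemma Fk_basis_glue t (Q : cones_k -> pred 'I_r) :
  [set Fk_basis t a | a : 'I_Fk_rank_val & Q (enum_val a).1 (enum_val a).2] =
  glue (fun s => [set tvb_basis E (val s) j | j : 'I_r & Q s j]).
Proof.
apply/setP=> -[s g]; rewrite [RHS]inE /=; apply/imsetP/imsetP.
  by move=> [a]; rewrite inE => Qa [-> ->]; exists (enum_val a).2; rewrite ?inE.
move=> [j]; rewrite inE => Qj ->; exists (enum_rank (s, j)).
  by rewrite inE enum_rankK.
by rewrite /Fk_basis enum_rankK.
Qed.

Lemma Fk_basisP t :
  is_basis Fk_matroid [set Fk_basis t a | a : 'I_Fk_rank_val].
Proof.
have -> : [set Fk_basis t a | a : 'I_Fk_rank_val] =
    glue (fun s : cones_k => [set tvb_basis E (val s) j | j : 'I_r]).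
  rewrite -imset_predT (Fk_basis_glue t (fun _ => xpredT)).
  by apply/setP=> -[s g]; rewrite [LHS]inE [RHS]inE /= imset_predT.
by apply: basis_glue => s; exact: tvb_basisP.
Qed.

Lemma Fk_filtE (t : S) p (i : int) : p \in rays t ->
  Fk_filt p i = mspan Fk_matroid
    [set Fk_basis t a |
       a : 'I_Fk_rank_val & i <= pairing (Fk_char t a) (prim_gen p)].
Proof.
move=> pt.
rewrite (Fk_basis_glue t (fun s j => i <= pairing (u (val s) t j) (prim_gen p))).
rewrite mspan_dsum; apply/setP=> -[s g]; rewrite [LHS]inE [RHS]inE /=.
by rewrite slice_glue (twisted_filtE (val s) i hu pt).
Qed.

(* The characters of F_k on t are the u^s_{t,j} with codim s = k and j < r,
   listed along an enumeration of the pairs (s, j). *)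
Definition Fk : tvb S #|{: {s : S | codim s == k} * 'I_r}| :=
  Tvb Fk_rank Fk_flat Fk_decr Fk_basis_inj Fk_basisP Fk_filtE.

End Twist.

(* Main.v *)
Require Import Defs.
From mathcomp Require Import boolp classical_sets reals sequences exp.
From mathcomp Require Import all_boot all_order all_algebra.

(* The multiset of restrictions of the characters u_{s,j} to a face g of s
   depends on E and g only: for subsets J, K of a basis one has
   span J :&: span K = span (J :&: K), so the number of j with
   <u_{s,j}, v_p> >= a_p for all rays p of g is the rank of the intersection
   of the flats F^p_{a_p}. Hence the inner sum attached to s depends only on
   the cone s :&: t, and is K_E(x) when s contains t. It remains to see that
   the signs (-1)^codim of the cones s with s :&: t = m add up to 1 if m = t
   and to 0 otherwise, which by descending induction on m follows from the
   Euler relation: the signs of all cones containing a given cone t0 add up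
   to 1.
   For the latter, fix a vector y. From each cone t containing t0 one enters, in
   direction y, the relative interior of a unique cone s; the cones t entering
   a fixed s form an interval of the simplex of faces of s, and their signs
   cancel unless the interval is reduced to s. The surviving s are those
   containing the cone entered from t0 in direction -y. This cone is
   strictly larger than t0 if y is not in the span of t0, so the sum is
   unchanged when t0 is replaced by larger and larger cones, up to a
   full-dimensional one. *)

Set Implicit Arguments.
Unset Strict Implicit.
Unset Printing Implicit Defensive.
Import Order.TTheory GRing.Theory Num.Theory.
Local Open Scope ring_scope.

(** * Spans in a matroid *)

Section MatroidSpans.
Variables (G : finType) (M : matroid G).
Implicit Types A B J K : {set G}.

Lemma mrank_indep J : indep M J -> mrank M J = #|J|.
Proof.
move=> iJ; apply/eqP; rewrite eqn_leq card_indep_le // andbT.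
by have [B [_ sB ->]] := mrank_witness M J; apply: subset_leq_card.
Qed.

(** An independent subset of [g |: J] larger than [J] must be all of [g |: J]. *)
Lemma mem_mspan_indep J g : indep M J ->
  (g \in mspan M J) = (g \in J) || ~~ indep M (g |: J).
Proof.
move=> iJ; rewrite inE (mrank_indep iJ).
case: (boolP (g \in J)) => [gJ|gJ] /=.
  by rewrite (setUidPr _) ?sub1set // mrank_indep // eqxx.
case: (boolP (indep M (g |: J))) => iU /=.
  by rewrite mrank_indep // cardsU1 gJ add1n gtn_eqF.
rewrite eqn_leq -{2}(mrank_indep iJ) mrankS ?subsetUr // andbT.
have [B [iB sB ->]] := mrank_witness M (g |: J).
rewrite leqNgt; apply: contra iU => lt.
suff <- : B = g |: J by [].
by apply/eqP; rewrite eqEcard sB cardsU1 gJ add1n.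
Qed.

(** A larger independent subset of the span would augment [J] by an element of the span, contrary to
    [mem_mspan_indep]. *)
Lemma mrank_mspan_indep J : indep M J -> mrank M (mspan M J) = #|J|.
Proof.
move=> iJ; apply/eqP; rewrite eqn_leq card_indep_le //; last first.
  by apply/subsetP=> g gJ; rewrite mem_mspan_indep // gJ.
have [B [iB sB ->]] := mrank_witness M (mspan M J).
rewrite andbT leqNgt; apply/negP => lt.
have [x /setDP[xB xJ] iU] := indep_aug iJ iB lt.
by have := subsetP sB _ xB; rewrite mem_mspan_indep // iU (negPf xJ).
Qed.

(** Augmentation from [B], repeated until the sizes agree. *)
Lemma indep_extend A B : indep M A -> indep M B -> (#|A| <= #|B|)%N ->
  exists C : {set G},
    [/\ A \subset C, C \subset A :|: B, indep M C & #|C| = #|B|].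
Proof.
move=> + iB; have [k] := ubnP (#|B| - #|A|)%N.
elim: k => // k IHk in A *; move=> le iA; rewrite leq_eqVlt.
case/predU1P => [e|lt]; first by exists A; rewrite subxx subsetUl.
have [x /setDP[xB xA] iU] := indep_aug iA iB lt.
have cU : #|x |: A| = #|A|.+1 by rewrite cardsU1 xA.
have [||C [sC CU iC cC]] := IHk _ _ iU; rewrite ?cU //.
  by rewrite subnS -ltnS prednK ?subn_gt0.
exists C; split=> //; first exact: subset_trans (subsetUr _ _) sC.
apply: subset_trans CU _; apply/subsetP=> y; rewrite !inE.
by case: eqP => [->|] //=; rewrite xB orbT.
Qed.

(* If g is not in the right-hand side, then g |: (J :&: K) extends, within
   g |: (J :|: K), to an independent set omitting a single element, hence
   containing g |: J or g |: K. *)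
Lemma mspanI J K : indep M (J :|: K) ->
  mspan M J :&: mspan M K = mspan M (J :&: K).
Proof.
move=> iJK; have iJ := indepS (subsetUl J K) iJK.
have iK := indepS (subsetUr J K) iJK.
have iI := indepS (subsetIl J K) iJ.
apply/setP=> g; rewrite in_setI !mem_mspan_indep //.
apply/andP/idP => [[gJ gK]|]; last first.
  rewrite inE => /orP[/andP[-> ->]//|dep]; split; apply/orP; right;
    apply: contra dep; apply: indepS; apply: setUS;
    [exact: subsetIl | exact: subsetIr].
apply: contraT => /norP[gI /negPn iU].
have gNJ : g \notin J.
  apply/negP => gJ'; move: gK; have gNK: g \notin K by rewrite inE gJ' in gI.
  rewrite (negPf gNK) /= => /negP; apply; apply: indepS iJK.
  by rewrite subUset sub1set subsetUr inE gJ'.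
have gNK : g \notin K.
  apply/negP => gK'; move: gJ; rewrite (negPf gNJ) /= => /negP; apply.
  by apply: indepS iJK; rewrite subUset sub1set subsetUl inE gK' orbT.
move: gJ gK; rewrite (negPf gNJ) (negPf gNK) /= => dJ dK.
(* Otherwise [J] and [K] coincide, and [iU] makes [g |: J] independent. *)
have le : (#|g |: (J :&: K)| <= #|J :|: K|)%N.
  rewrite cardsU1 gI add1n ltnNge; apply: contra dJ => le.
  suff -> : J = J :&: K by [].
  apply/eqP; rewrite eq_sym eqEcard subsetIl; apply: leq_trans le.
  exact: subset_leq_card (subsetUl _ _).
have [C [sC CU iC cC]] := indep_extend iU iJK le.
have gC : g \in C by apply: (subsetP sC); rewrite !inE eqxx.
have [e1 e1J e1C] : exists2 e, e \in J & e \notin C.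
  apply/subsetPn; apply: contra dJ => sJ; apply: indepS iC.
  by rewrite subUset sub1set gC.
have [e2 e2K e2C] : exists2 e, e \in K & e \notin C.
  apply/subsetPn; apply: contra dK => sK; apply: indepS iC.
  by rewrite subUset sub1set gC.
have e12 : e1 != e2.
  apply/eqP => e; move: e1C; rewrite (subsetP sC) //.
  by rewrite in_setU in_setI e1J e e2K orbT.
have sD : [set e1; e2] \subset (g |: (J :|: K)) :\: C.
  by rewrite subUset !sub1set !inE e1C e2C e1J e2K !orbT.
have sCg : C \subset g |: (J :|: K).
  apply: subset_trans CU _; rewrite subUset subsetUr andbT setUS //.
  exact: subset_trans (subsetIl _ _) (subsetUl _ _).
have := subset_leq_card sD; rewrite cards2 e12 cardsD (setIidPr sCg).
by rewrite cardsU1 inE negb_or gNJ gNK cC addnK.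
Qed.

End MatroidSpans.

(** * The characters on a common face *)

Section UpperCounts.
Variables (T : finType) (D : {set T}).
Implicit Types (J : finType) (A : {set T}) (a : T -> int).

(* Exact values are prescribed on A, lower bounds on D minus A. *)
Let mixed J (F : J -> T -> int) A a : {set J} :=
  [set j | [forall p in D, if p \in A then F j p == a p else a p <= F j p]].

(** If [a q <= F j q], then either equality holds or, the values being integers,
    [a q + 1 <= F j q]. *)
Let card_mixed J (F : J -> T -> int) A a q : q \in A -> q \in D ->
  (#|mixed F A a| + #|mixed F (A :\ q) (fun p => a p + (p == q)%:R)%R|)%N =
  #|mixed F (A :\ q) a|.
Proof.
move=> qA qD; rewrite -(cardsID [set j | F j q == a q] (mixed F (A :\ q) a)).
congr (_ + _)%N; apply: eq_card => j; rewrite !inE.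
  apply/forall_inP/andP => [H|[/forall_inP H /eqP jq] p pD].
    split; last by have := H q qD; rewrite qA.
    apply/forall_inP => p pD; have := H p pD; rewrite in_setD1.
    by case: (eqVneq p q) => [->|//]; rewrite qA => /eqP -> /=.
  have := H p pD; rewrite in_setD1; case: (eqVneq p q) => [->|//] _.
  by rewrite qA jq.
apply/forall_inP/andP => [H|[jq /forall_inP H] p pD].
  split.
    by have := H q qD; rewrite !inE !eqxx /= lezD1 => lt; rewrite gt_eqF.
  apply/forall_inP => p pD; have := H p pD; rewrite in_setD1.
  case: (eqVneq p q) => [->|_] /=; last by rewrite addr0.
  by apply: le_trans; rewrite lerDl.
have := H p pD; rewrite in_setD1; case: (eqVneq p q) => [->|_] /=.
  by rewrite lezD1 le_eqVlt eq_sym (negPf jq).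
by rewrite addr0.
Qed.

(** Exact counts are iterated differences of counts with lower bounds: [card_mixed] carries the
    equality, for all [a] at once, from [A :\ q] to [A]. *)
Lemma card_eq_of_card_ge J J' (F : J -> T -> int) (F' : J' -> T -> int) :
  (forall a, #|[set j | [forall p in D, a p <= F j p]]| =
             #|[set j | [forall p in D, a p <= F' j p]]|) ->
  forall a, #|[set j | [forall p in D, F j p == a p]]| =
            #|[set j | [forall p in D, F' j p == a p]]|.
Proof.
move=> H a.
suff gen A : A \subset D -> forall a, #|mixed F A a| = #|mixed F' A a|.
  have := gen D (subxx D) a; rewrite /mixed.
  have e (K : finType) (h : K -> T -> int) : #|[set j | [forall p in D,
      if p \in D then h j p == a p else a p <= h j p]]| =
      #|[set j | [forall p in D, h j p == a p]]|.
    apply: eq_card => j; rewrite !inE; apply: eq_forallb => p.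
    by case: (p \in D).
  by rewrite !e.
have [k] := ubnP #|A|; elim: k A => // k IH A.
have [->|[q qA]] := set_0Vmem A => le sAD b.
  have e (K : finType) (h : K -> T -> int) : #|mixed h set0 b| =
      #|[set j | [forall p in D, b p <= h j p]]|.
    apply: eq_card => j; rewrite !inE; apply: eq_forallb => p.
    by rewrite inE.
  by rewrite !e H.
have qD := subsetP sAD _ qA.
have lt : (#|A :\ q| < k)%N by move: le; rewrite (cardsD1 q A) qA.
have IHq := IH _ lt (subset_trans (subD1set A q) sAD).
have := card_mixed F b qA qD; rewrite (IHq b) IHq.
by rewrite -(card_mixed F' b qA qD) => /addIn.
Qed.

(** Extension by 0 outside [D] turns restrictions to [D] into elements of an [eqType], whose
    multiplicities can be compared. *)
Definition restr (h : T -> int) : {ffun T -> int} :=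
  [ffun p => if p \in D then h p else 0].

Lemma sum_restr_of_card_ge J J' (F : J -> T -> int) (F' : J' -> T -> int)
    (V : nmodType) (phi : {ffun T -> int} -> V) :
  (forall a, #|[set j | [forall p in D, a p <= F j p]]| =
             #|[set j | [forall p in D, a p <= F' j p]]|) ->
  \sum_j phi (restr (F j)) = \sum_j phi (restr (F' j)).
Proof.
move=> H.
have -> : \sum_j phi (restr (F j)) =
    \sum_(v <- [seq restr (F j) | j <- index_enum J]) phi v.
  by rewrite big_map.
have -> : \sum_j phi (restr (F' j)) =
    \sum_(v <- [seq restr (F' j) | j <- index_enum J']) phi v.
  by rewrite big_map.
apply: perm_big; apply/allP => v _ /=; apply/eqP; rewrite !count_map.
(* A function that is nonzero somewhere outside [D] has multiplicity 0; for the others the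
   multiplicity is an exact count on [D]. *)
have e (K : finType) (h : K -> T -> int) :
    count (preim (fun j => restr (h j)) (pred1 v)) (index_enum K) =
    if [forall p, (p \notin D) ==> (v p == 0)]
    then #|[set j | [forall p in D, h j p == v p]]| else 0%N.
  rewrite -sum1_count sum1dep_card; case: ifPn => [/forall_inP v0|].
    apply: eq_card => j; rewrite !inE /=.
    apply/eqP/forall_inP => [<- p pD|hv]; first by rewrite ffunE pD.
    apply/ffunP => p; rewrite ffunE; case: ifPn => [/hv/eqP//|/v0/eqP->//].
  move=> /forall_inPn[p pD vp]; apply: eq_card0 => j; rewrite !inE /=.
  by apply: contraNF vp => /eqP <-; rewrite ffunE (negPf pD).
by rewrite !e (card_eq_of_card_ge H).
Qed.

End UpperCounts.

Section CharacterMultisets.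
Variables (R : realType) (n : nat) (S : fan R n) (r : nat) (E : tvb S r).
Implicit Types (s : S) (A : {set ray S}).

(** The flats are spanned by subsets of the one basis attached to [s], so [mspanI] applies ray by
    ray. *)
Lemma filt_bigcap s (l : seq (ray S)) (a : ray S -> int) :
  {subset l <= rays s} ->
  \bigcap_(p <- l) filt E p (a p) = mspan (tvb_matroid E)
    [set tvb_basis E s j | j : 'I_r &
       all (fun p => a p <= pairing (tvb_char E s j) (prim_gen p)) l].
Proof.
have iB : indep (tvb_matroid E) [set tvb_basis E s j | j : 'I_r].
  exact: maxsetp (tvb_basisP E s).
elim: l => [|p l IH] sl.
  by rewrite big_nil /= imset_predT (mspan_basis (tvb_basisP E s)).
rewrite big_cons IH; last by move=> q ql; apply: sl; rewrite inE ql orbT.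
rewrite (filtE E (s := s)); last by apply: sl; rewrite inE eqxx.
rewrite mspanI; last first.
  by apply: indepS iB; rewrite subUset !imsetS //; apply/subsetP.
congr mspan; rewrite -imsetI; last by move=> x y _ _; apply: tvb_basis_inj.
by apply/setP=> g; apply/imsetP/imsetP=> -[j jP ->]; exists j => //;
  move: jP; rewrite !inE.
Qed.

(** Both counts are the rank of an intersection of flats that does not involve the cone. *)
Lemma card_char_ge s s' A (a : ray S -> int) :
  A \subset rays s -> A \subset rays s' ->
  #|[set j | [forall p in A, a p <= pairing (tvb_char E s j) (prim_gen p)]]| =
  #|[set j | [forall p in A, a p <= pairing (tvb_char E s' j) (prim_gen p)]]|.
Proof.
have e s1 : A \subset rays s1 ->
  #|[set j | [forall p in A, a p <= pairing (tvb_char E s1 j) (prim_gen p)]]| =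
  mrank (tvb_matroid E) (\bigcap_(p <- enum A) filt E p (a p)).
  move=> /subsetP sA; rewrite (@filt_bigcap s1); last first.
    by move=> p; rewrite mem_enum => /sA.
  rewrite mrank_mspan_indep; last first.
    apply: indepS (maxsetp (tvb_basisP E s1)).
    by rewrite imsetS //; apply/subsetP.
  rewrite card_imset; last exact: tvb_basis_inj.
  apply: eq_card => j; rewrite !inE; apply/forall_inP/allP => H p.
    by rewrite mem_enum => /H.
  by move=> pA; apply: H; rewrite mem_enum.
by move=> sA sA'; rewrite !e.
Qed.

Lemma sum_char_restr s s' A (V : nmodType) (phi : {ffun ray S -> int} -> V) :
  A \subset rays s -> A \subset rays s' ->
  \sum_(j < r) phi (restr A (fun p => pairing (tvb_char E s j) (prim_gen p))) =
  \sum_(j < r) phi (restr A (fun p => pairing (tvb_char E s' j) (prim_gen p))).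
Proof.
by move=> sA sA'; apply: sum_restr_of_card_ge => a; apply: card_char_ge.
Qed.

End CharacterMultisets.

(** * Polyhedral cones *)

Section Pairing.
Variables (A : comPzRingType) (n : nat).
Implicit Types u v w : 'rV[A]_n.

Lemma pairingDr u v w : pairing u (v + w) = pairing u v + pairing u w.
Proof. by rewrite -big_split; apply: eq_bigr => i _; rewrite mxE mulrDr. Qed.

Lemma pairingZr u c v : pairing u (c *: v) = c * pairing u v.
Proof. by rewrite mulr_sumr; apply: eq_bigr => i _; rewrite mxE mulrCA. Qed.

Lemma pairing0r u : pairing u 0 = 0.
Proof. by apply: big1 => i _; rewrite mxE mulr0. Qed.

Lemma pairingNr u v : pairing u (- v) = - pairing u v.
Proof. by rewrite -scaleN1r pairingZr mulN1r. Qed.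

Lemma pairing_sumr u (I : Type) (l : seq I) (P : pred I) (F : I -> 'rV[A]_n) :
  pairing u (\sum_(i <- l | P i) F i) = \sum_(i <- l | P i) pairing u (F i).
Proof. by apply: (big_morph _ (pairingDr u) (pairing0r u)). Qed.

Lemma pairingC u v : pairing u v = pairing v u.
Proof. by apply: eq_bigr => i _; rewrite mulrC. Qed.

Lemma pairing_suml (I : Type) (l : seq I) (P : pred I) (F : I -> 'rV[A]_n) u :
  pairing (\sum_(i <- l | P i) F i) u = \sum_(i <- l | P i) pairing (F i) u.
Proof.
by rewrite pairingC pairing_sumr; apply: eq_bigr => i _; rewrite pairingC.
Qed.

Lemma pairingBl u v w : pairing (u - v) w = pairing u w - pairing v w.
Proof. by rewrite pairingC pairingDr pairingNr ![pairing w _]pairingC. Qed.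

End Pairing.

Lemma pairing_lat (R : realType) (n : nat) (u v : 'rV[int]_n) :
  pairing (lat R u) (lat R v) = (pairing u v)%:~R.
Proof.
rewrite [RHS]rmorph_sum; apply: eq_bigr => i _.
by rewrite !mxE rmorphM.
Qed.

Lemma latZ (R : realType) (n : nat) (d : int) (v : 'rV[int]_n) :
  lat R (d *: v) = d%:~R *: lat R v.
Proof. by apply/rowP => i; rewrite !mxE rmorphM. Qed.

Lemma lat_inj (R : realType) (n : nat) : injective (@lat R n).
Proof.
move=> u v /rowP e; apply/rowP => i; apply: (intr_inj (R := R)).
by have := e i; rewrite !mxE.
Qed.

Lemma lat0 (R : realType) (n : nat) : lat R (0 : 'rV[int]_n) = 0.
Proof. by apply/rowP => i; rewrite !mxE. Qed.

Lemma primitive_neq0 (n : nat) (v : 'rV[int]_n) : primitive v -> v != 0.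
Proof.
by move=> pv; apply/eqP => v0; have := pv 0 0; rewrite scaler0 v0 => /(_ erefl).
Qed.

(** The factor [g] is the gcd of the coordinates. *)
Lemma exists_primitive (n : nat) (v : 'rV[int]_n) : v != 0 ->
  exists2 g : nat, (0 < g)%N & exists2 w, primitive w & v = g%:Z *: w.
Proof.
move=> v0; pose g := (\big[gcdn/0]_i `|v 0%R i|)%N.
have gv i : (g %| `|v 0%R i|)%N by apply: biggcdn_inf (dvdnn _).
have g0 : (0 < g)%N.
  rewrite lt0n; apply: contraNneq v0 => g0; apply/eqP/rowP => i.
  by have := gv i; rewrite g0 dvd0n absz_eq0 mxE => /eqP.
exists g => //; exists (\row_i (v 0%R i %/ g%:Z)%Z).
  move=> d w e; suff /eqP d1 : `|d|%N == 1%N by rewrite -abszE d1.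
  rewrite -(eqn_pmul2l g0) muln1.
  (* The product of [g] and [d] still divides every coordinate of [v], hence their gcd. *)
  suff : (g * `|d| %| g)%N.
    by move=> dv; rewrite eqn_dvd dv dvdn_mulr.
  rewrite {2}/g; apply/dvdn_biggcdP => i _.
  have -> : v 0 i = g%:Z * (d * w 0 i).
    have := congr1 (fun M : 'rV_n => M 0 i) e; rewrite !mxE => <-.
    by rewrite mulrC divzK // /dvdz; apply: gv.
  by rewrite mulrA !abszM dvdn_mulr.
apply/rowP => i; rewrite !mxE mulrC divzK // /dvdz; apply: gv.
Qed.

Section ConeGeometry.
Variables (R : realType) (n : nat).
Implicit Types (C : set 'rV[R]_n) (x y v : 'rV[R]_n).

Lemma conic1P v x : conic [:: v] x <-> exists2 c, 0 <= c & x = c *: v.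
Proof.
split=> [[c [c0 ->]]|[c c0 ->]].
  by exists (c ord0); rewrite ?big_ord_recl ?big_ord0 ?addr0.
by exists (fun=> c); split=> //; rewrite big_ord_recl big_ord0 addr0.
Qed.

Lemma mem_conic (s : seq 'rV[R]_n) v : v \in s -> conic s v.
Proof.
move=> vs; have lt : (index v s < size s)%N by rewrite index_mem.
exists (fun i => (i == Ordinal lt)%:R); split=> [i|]; first by rewrite ler0n.
rewrite (bigD1 (Ordinal lt)) //= eqxx scale1r nth_index // big1 ?addr0 // => i.
by move=> /negPf ->; rewrite scale0r.
Qed.

Lemma lin_span_eq C (V : {vspace 'rV[R]_n}) : (forall x, C x -> x \in V) ->
  (forall W : {vspace 'rV[R]_n}, (forall x, C x -> x \in W) -> (V <= W)%VS) ->
  lin_span C = V.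
Proof.
move=> CV minV; rewrite /lin_span; case: xgetP => [W _ [CW minW]|/(_ V) []//].
by apply/eqP; rewrite eqEsubv minW ?minV.
Qed.

Lemma lin_span_conic (s : seq 'rV[R]_n) : lin_span (conic s) = <<s>>%VS.
Proof.
apply: lin_span_eq => [x [c [_ ->]]|W sW].
  by apply: memv_suml => i _; apply/memvZ/memv_span/mem_nth.
by apply/span_subvP => v vs; apply: sW; apply: mem_conic.
Qed.

(** One threshold serves a whole finite list and remains valid when enlarged, so that several
    thresholds can be combined. *)
Lemma large_multiple (T : eqType) (l : seq T) (f g : T -> R) :
  exists2 N, 0 <= N &
    forall M a, N <= M -> a \in l -> 0 < f a -> 0 < g a + M * f a.
Proof.
elim: l => [|b l [N N0 HN]]; first by exists 0.
exists (Num.max N ((`|g b| + 1) / f b)); first by rewrite le_max N0.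
move=> M a; rewrite ge_max => /andP[NM bM]; rewrite inE => /predU1P[->|al].
  move=> fb; move: bM; rewrite ler_pdivrMr // => bM.
  have := ler_norm (- g b); rewrite normrN => gb.
  rewrite -ltrBlDl sub0r (le_lt_trans gb) // (lt_le_trans _ bM) //.
  by rewrite ltrDl.
exact: HN.
Qed.

(* Sliding x along -y inside C until a new facet is met. *)
Lemma touch_facet C (L : seq 'rV[R]_n) x y :
  (forall z, C z <-> forall a, a \in L -> 0 <= pairing a z) ->
  strictly_convex C -> C x -> C y -> y != 0 ->
  exists t, [/\ 0 <= t, C (x - t *: y) &
    exists a, [/\ a \in L, 0 < pairing a y & pairing a (x - t *: y) = 0]].
Proof.
move=> CL sC Cx Cy y0.
(* Only the inequalities in [L'] tighten along [-y]; [t] is the least ratio, where the first of them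
   becomes an equality. If [L'] were empty, [-y] would lie in [C]. *)
pose L' := [seq a <- L | 0 < pairing a y].
have [t [a aL' [ta tmin]]] : exists t, exists2 a, a \in L' &
    t = pairing a x / pairing a y /\
    forall b, b \in L' -> t <= pairing b x / pairing b y.
  have : L' != [::].
    apply: contraNneq y0 => L'0; apply/eqP/sC => //; apply/CL => a aL.
    rewrite pairingNr oppr_ge0 leNgt; apply/negP => lt.
    have : a \in L' by rewrite mem_filter lt.
    by rewrite L'0.
  elim: L' => // b [|b' l] IH _.
    by exists (pairing b x / pairing b y), b;
      rewrite ?mem_head //; split=> // c; rewrite inE => /eqP ->.
  have [t [a al [ta tmin]]] := IH isT.
  have [le|lt] := leP t (pairing b x / pairing b y).
    exists t, a; first by rewrite inE al orbT.
    by split=> // c; rewrite inE => /predU1P[->//|]; apply: tmin.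
  exists (pairing b x / pairing b y), b; first exact: mem_head.
  split=> // c; rewrite inE => /predU1P[->//|cl].
  exact: le_trans (ltW lt) (tmin c cl).
move: (aL'); rewrite mem_filter => /andP[ay aL].
have ax : 0 <= pairing a x by apply: (CL x).1.
exists t; split.
- by rewrite ta divr_ge0 // ltW.
- apply/CL => b bL; rewrite pairingDr pairingNr pairingZr subr_ge0.
  have := (CL y).1 Cy b bL; rewrite le_eqVlt => /predU1P[<-|by0].
    by rewrite mulr0; apply: (CL x).1.
  by rewrite -ler_pdivlMr // tmin // mem_filter by0.
- exists a; split=> //; rewrite pairingDr pairingNr pairingZr ta.
  by rewrite divfK ?subrr // gt_eqF.
Qed.

End ConeGeometry.

(** * Fans and their rays *)

Lemma count_lt (T : eqType) (P Q : pred T) (l : seq T) a :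
  {in l, forall b, P b -> Q b} -> a \in l -> Q a -> ~~ P a ->
  (count P l < count Q l)%N.
Proof.
move=> PQ al Qa Pa.
rewrite -(size_filter Q) -(count_predC P) !count_filter -addn1 leq_add //.
  apply/eq_leq/eq_in_count => b bl /=.
  by case: (boolP (P b)) => // /(PQ _ bl) ->.
by rewrite -has_count; apply/hasP; exists a; rewrite //= Pa.
Qed.

Section FanGeometry.
Variables (R : realType) (n : nat) (S : fan R n).
Implicit Types (s t : S) (p q : ray S) (x y : 'rV[R]_n).

Definition vgen p : 'rV[R]_n := lat R (prim_gen p).

Lemma carrierZ s c x : 0 <= c -> carrier s x -> carrier s (c *: x).
Proof.
move=> c0; have [l ->] := carrier_rational s => -[d [d0 ->]].
exists (fun i => c * d i); split=> [i|]; first exact: mulr_ge0.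
by rewrite scaler_sumr; apply: eq_bigr => i _; rewrite scalerA.
Qed.

Lemma carrierD s x y : carrier s x -> carrier s y -> carrier s (x + y).
Proof.
have [l ->] := carrier_rational s => -[d [d0 ->]] [e [e0 ->]].
exists (fun i => d i + e i); split=> [i|]; first exact: addr_ge0.
by rewrite -big_split; apply: eq_bigr => i _; rewrite scalerDl.
Qed.

Lemma carrier0 s : carrier s 0.
Proof.
have [l ->] := carrier_rational s.
by exists (fun=> 0); split=> //; rewrite big1 // => i _; rewrite scale0r.
Qed.

Lemma carrier_sum s (I : finType) (P : pred I) (c : I -> R)
    (F : I -> 'rV[R]_n) :
  (forall i, P i -> 0 <= c i) -> (forall i, P i -> carrier s (F i)) ->
  carrier s (\sum_(i | P i) c i *: F i).
Proof.
move=> c0 sF; apply: (big_ind (carrier s)) => [||i Pi].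
- exact: carrier0.
- exact: carrierD.
- by apply: carrierZ; [apply: c0|apply: sF].
Qed.

(** A cone contained in [t] equals its intersection with [t], which is a face by [carrier_inter]. *)
Lemma face_sub s t : is_face (carrier s) (carrier t) <->
  (forall x, carrier s x -> carrier t x).
Proof.
split=> [[w [_ ->]] x []//|sub].
have -> : carrier s = (carrier s `&` carrier t)%classic.
  by apply/seteqP; split=> x; [split; last apply: sub|case].
by have [] := carrier_inter s t.
Qed.

(** All generators of a one-dimensional strictly convex cone are nonnegative multiples of a nonzero
    one, which is then divided by the gcd of its coordinates. Hence the default value in [prim_gen]
    is never taken. *)
Lemma prim_gen_spec p :
  primitive (prim_gen p) /\ carrier (val p) = conic [:: vgen p].
Proof.
rewrite /vgen /prim_gen; case: xgetP => [v _ [] //|none]; exfalso.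
have [l cl] := carrier_rational (val p).
have := valP p; rewrite /cone_dim cl lin_span_conic => /eqP dim1.
have [v vl v0] : exists2 v, v \in l & lat R v != 0.
  apply/hasP; apply: contra_eqT dim1 => /hasPn l0.
  suff -> : <<[seq lat R v | v <- l]>>%VS = 0%VS by rewrite dimv0.
  apply/eqP; rewrite -subv0; apply/span_subvP => _ /mapP[v vl ->].
  by rewrite memv0; move: (l0 v vl); rewrite negbK.
have line w : w \in l -> exists2 c, 0 <= c & lat R w = c *: lat R v.
  move=> wl; have mem a : a \in l -> lat R a \in <<[seq lat R v | v <- l]>>%VS.
    by move=> al; apply/memv_span/map_f.
  have e : <<[seq lat R v | v <- l]>>%VS = <[lat R v]>%VS.
    apply/eqP; rewrite eq_sym eqEdim dim1 dim_vline v0 leqnn andbT.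
    by rewrite -memvE mem.
  have := mem w wl; rewrite e => /vlineP[c cw]; exists c => //.
  (* A negative [c] would put both [lat R v] and its opposite in the cone. *)
  rewrite leNgt; apply/negP => clt; move/eqP: v0; apply.
  apply: (carrier_strict (s := val p)).
    by rewrite cl; apply/mem_conic/map_f.
  have -> : - lat R v = (- c^-1) *: lat R w.
    by rewrite cw scalerA mulNr mulVf ?lt_eqF // scaleN1r.
  apply: carrierZ; first by rewrite oppr_ge0 invr_le0 ltW.
  by rewrite cl; apply/mem_conic/map_f.
have vN0 : v != 0 by apply: contraNneq v0 => ->; rewrite lat0.
have [g g0 [w pw vw]] := exists_primitive vN0.
have gR : (0 : R) < g%:Z%:~R by rewrite ltr0z.
apply: (none w); split=> //; apply/seteqP; split=> x.
  rewrite cl => -[c [c0 ->]].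
  have -> : \sum_i c i *: [seq lat R v | v <- l]`_i =
     (\sum_i c i * (xget 0 [set d : R | 0 <= d /\
       [seq lat R v | v <- l]`_i = d *: lat R w]%classic)) *: lat R w.
    rewrite scaler_suml; apply: eq_bigr => i _; rewrite -scalerA.
    congr (_ *: _).
    case: xgetP => [d _ []//|nod]; exfalso.
    have /mapP[a al ea] := mem_nth 0 (ltn_ord i).
    have [d d0 ad] := line a al.
    apply: (nod (d * g%:Z%:~R)); split; first by rewrite mulr_ge0 // ltW.
    by rewrite ea ad vw latZ scalerA.
  apply/conic1P; eexists; last reflexivity.
  apply: sumr_ge0 => i _; apply: mulr_ge0 => //.
  by case: xgetP => [d _ []|].
move=> /conic1P[c c0 ->].
have -> : lat R w = g%:Z%:~R^-1 *: lat R v.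
  by rewrite vw latZ scalerA mulVf ?scale1r // gt_eqF.
apply: carrierZ => //; apply: carrierZ; first by rewrite invr_ge0 ltW.
by rewrite cl; apply/mem_conic/map_f.
Qed.

Lemma ray_carrier p x :
  carrier (val p) x <-> exists2 c, 0 <= c & x = c *: vgen p.
Proof. by have [_ ->] := prim_gen_spec p; apply: conic1P. Qed.

Lemma vgen_inj : injective vgen.
Proof.
move=> p q e; apply/val_inj/carrier_inj; have [_ ->] := prim_gen_spec p.
by have [_ ->] := prim_gen_spec q; rewrite e.
Qed.

Lemma mem_rays s p : (p \in rays s) = `[< carrier s (vgen p) >].
Proof.
rewrite inE; apply/asboolP/asboolP => [/face_sub|vs]; first apply.
  by apply/ray_carrier; exists 1; rewrite ?scale1r.
by apply/face_sub => x /ray_carrier[c c0 ->]; apply: carrierZ.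
Qed.

Section Projective.
Hypothesis S_proj : projective S.

(** A normal cone is cut out by the differences [m' - m], where [m] is a minimizer for [w] and [m']
    any element of [P]. *)
Lemma carrier_halfspaces s : exists L : seq 'rV[R]_n,
  forall x, carrier s x <-> forall a, a \in L -> 0 <= pairing a x.
Proof.
have [P _ HP] := S_proj; have [w ->] := (HP (carrier s)).1 (ex_intro _ s erefl).
exists [seq lat R m' - lat R m | m <- [seq m <- P | `[< minimizes P w m >]],
                                m' <- P] => x; split.
  move=> xw a /allpairsP[[m m'] /= []].
  rewrite mem_filter => /andP[/asboolP mw mP] m'P ->.
  by rewrite pairingBl subr_ge0; have [_] := xw m mw; apply.
move=> H m mw; have [mP _] := mw; split=> // m' m'P.
rewrite -subr_ge0 -pairingBl; apply: H; apply/allpairsP; exists (m, m').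
by split=> //=; rewrite mem_filter mP andbT; apply/asboolP.
Qed.

Lemma carrier_cover x : exists s, carrier s x.
Proof.
have [P _ HP] := S_proj.
have [s e] := (HP (normal_cone P x)).2 (ex_intro _ x erefl).
by exists s; rewrite e.
Qed.

Let in_rays_cone s x :=
  exists2 c : ray S -> R, forall p, 0 <= c p &
    x = \sum_(p in rays s) c p *: vgen p.

Let in_rays_coneD s x y : in_rays_cone s x -> in_rays_cone s y ->
  in_rays_cone s (x + y).
Proof.
move=> [c c0 ->] [d d0 ->]; exists (fun p => c p + d p).
  by move=> p; rewrite addr_ge0.
by rewrite -big_split; apply: eq_bigr => p _; rewrite scalerDl.
Qed.

Let in_rays_coneZ s a x : 0 <= a -> in_rays_cone s x -> in_rays_cone s (a *: x).
Proof.
move=> a0 [c c0 ->]; exists (fun p => a * c p).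
  by move=> p; rewrite mulr_ge0.
by rewrite scaler_sumr; apply: eq_bigr => p _; rewrite scalerA.
Qed.

(* Unless x spans its minimal face, that face contains some z not proportional
   to x. Sliding x along z and z along x reaches two points on smaller faces,
   and x is a nonnegative combination of them. *)
Lemma carrier_gen s x : carrier s x -> exists2 c : ray S -> R,
  forall p, 0 <= c p & x = \sum_(p in rays s) c p *: vgen p.
Proof.
have [L HL] := carrier_halfspaces s.
have [k] := ubnP (count (fun a => pairing a x != 0) L).
elim: k x => // k IH x; rewrite ltnS => lek xs.
have [->|x0] := eqVneq x 0.
  by exists (fun=> 0) => //; rewrite big1 // => p _; rewrite scale0r.
(* These [y] form the linear span of the minimal face of [x]. *)
pose tight y := forall a, a \in L -> pairing a x = 0 -> pairing a y = 0.
have IHt y : carrier s y -> tight y ->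
    (exists a, [/\ a \in L, 0 < pairing a x & pairing a y = 0]) ->
    in_rays_cone s y.
  move=> ys ty [a [aL ax ay]]; apply: IH => //; apply: leq_trans lek.
  apply: (@count_lt _ _ _ _ a) => //; first last.
  - by rewrite ay eqxx.
  - by rewrite gt_eqF.
  by move=> b bL; apply: contraNneq => bx; rewrite ty.
have [[y ty yx]|noy] := pselect (exists2 y, tight y & y \notin <[x]>%VS).
  have xpos a : a \in L -> pairing a x != 0 -> 0 < pairing a x.
    by move=> aL ax; rewrite lt_def ax (HL x).1.
  have [N N0 HN] :=
    large_multiple L (fun a => pairing a x) (fun a => pairing a y).
  (* A large multiple of [x] brings [y] into the cone; the result is still tight and not
     proportional to [x]. *)
  pose z := y + N *: x.
  have tz : tight z.
    by move=> a aL ax; rewrite pairingDr pairingZr ty // ax mulr0 addr0.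
  have zs : carrier s z.
    apply/HL => a aL; have [ax|ax] := eqVneq (pairing a x) 0.
      by rewrite tz.
    by rewrite pairingDr pairingZr ltW // HN // xpos.
  have zx : z \notin <[x]>%VS.
    apply: contra yx => zx; rewrite -(addrK (N *: x) y).
    by rewrite memvB // memvZ // memv_line.
  have z0 : z != 0 by apply: contraNneq zx => ->; rewrite mem0v.
  have [t1 [t10 z's [a [aL ax az']]]] :=
    touch_facet HL (@carrier_strict _ _ _ s) zs xs x0.
  have [t2 [t20 x's [b [bL bz bx']]]] :=
    touch_facet HL (@carrier_strict _ _ _ s) xs zs z0.
  have Qz' : in_rays_cone s (z - t1 *: x).
    apply: IHt => //; last by exists a.
    move=> c cL cx; rewrite pairingDr pairingNr pairingZr.
    by rewrite tz // cx mulr0 subr0.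
  have Qx' : in_rays_cone s (x - t2 *: z).
    apply: IHt => //.
      move=> c cL cx; rewrite pairingDr pairingNr pairingZr.
    by rewrite tz // cx mulr0 subr0.
    exists b; split=> //; apply: xpos => //; apply: contraTneq bz => bx.
    by rewrite tz // ltxx.
  have e : (x - t2 *: z) + t2 *: (z - t1 *: x) = (1 - t2 * t1) *: x.
    by rewrite scalerBr addrA subrK scalerA scalerBl scale1r.
  (* If [t2 * t1 >= 1], both [x - t2 *: z] and its opposite lie in the cone, so it vanishes and [z]
     is proportional to [x]. *)
  have [lt1|le1] := ltP (t2 * t1) 1.
    suff -> : x = (1 - t2 * t1)^-1 *: ((x - t2 *: z) + t2 *: (z - t1 *: x)).
      apply: in_rays_coneZ; first by rewrite invr_ge0 subr_ge0 ltW.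
      by apply: in_rays_coneD => //; apply: in_rays_coneZ.
    by rewrite e scalerA mulVf ?scale1r // subr_eq0 gt_eqF.
  exfalso; have x'0 : x - t2 *: z = 0.
    apply: (carrier_strict (s := s)) => //.
    have -> : - (x - t2 *: z) = t2 *: (z - t1 *: x) + (t2 * t1 - 1) *: x.
      rewrite -[_ * t1 - 1]opprB scaleNr -e; set X := x - _; set Y := t2 *: _.
      by rewrite [- (X + Y)]opprD addrC subrK.
    by apply: carrierD; apply: carrierZ => //; rewrite subr_ge0.
  move/negP: zx; apply; have t2N0 : t2 != 0.
    apply: contraNneq x0 => t20'; move: x'0.
    by rewrite t20' scale0r subr0 => ->.
  have -> : z = t2^-1 *: x.
    move/eqP: x'0; rewrite subr_eq0 => /eqP ->.
    by rewrite scalerA mulVf ?scale1r.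
  by rewrite memvZ ?memv_line.
(* Now [x] spans its minimal face, which [w], the sum of the inequalities tight at [x], cuts out;
   this face is a ray. *)
pose w := \sum_(a <- L | pairing a x == 0) a.
have wE y : pairing w y = \sum_(a <- L | pairing a x == 0) pairing a y.
  exact: pairing_suml.
have w0 y : carrier s y -> 0 <= pairing w y.
  move=> ys; rewrite wE big_seq_cond sumr_ge0 // => a /andP[aL _].
  exact: (HL y).1.
have fF : is_face (carrier s `&` [set y | pairing w y = 0])%classic (carrier s).
  by exists w; split.
have xF : (carrier s `&` [set y | pairing w y = 0])%classic x.
  by split=> //=; rewrite wE big1 // => a /eqP.
have Fx y : (carrier s `&` [set y | pairing w y = 0])%classic y ->
    y \in <[x]>%VS.
  move=> [ys /= wy]; apply: contra_notT noy => yx; exists y => // a aL ax.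
  apply/eqP; move/eqP: wy; rewrite wE big_seq_cond psumr_eq0; last first.
    by move=> b /andP[bL _]; apply: (HL y).1.
  by move=> /allP/(_ a aL); rewrite aL ax eqxx.
have [t tF] := carrier_face fF.
have dimt : cone_dim (carrier t) == 1%N.
  rewrite /cone_dim tF (@lin_span_eq _ _ _ <[x]>%VS) ?dim_vline ?x0 //.
  by move=> W sW; rewrite -memvE; apply: sW.
pose p : ray S := exist _ t dimt.
have ps : p \in rays s by rewrite inE; apply/asboolP; rewrite /= tF.
have [c c0 xc] : exists2 c, 0 <= c & x = c *: vgen p.
  by apply/ray_carrier; rewrite /= tF.
exists (fun q => c *+ (q == p)); first by move=> q; rewrite mulrn_wge0.
rewrite (bigD1 p) //= eqxx -xc big1 ?addr0 // => q /andP[_ /negPf ->].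
by rewrite scale0r.
Qed.

End Projective.

End FanGeometry.

(** * Simplicial structure *)

Section SimplicialFan.
Variables (R : realType) (n : nat) (S : fan R n).
Hypotheses (S_smooth : smooth S) (S_proj : projective S).
Implicit Types (s t : S) (p q : ray S) (x y : 'rV[R]_n).

(** The generators are distinct rows of an invertible integer matrix, and the columns of its inverse
    form the dual basis. *)
Lemma exists_dual s : exists d : ray S -> 'rV[R]_n,
  forall p q, p \in rays s -> q \in rays s ->
    pairing (d p) (vgen q) = (p == q)%:R.
Proof.
have [A Au HA] := S_smooth s.
suff /choice[d Hd] : forall p, exists dp : 'rV[R]_n, p \in rays s ->
    forall q, q \in rays s -> pairing dp (vgen q) = (p == q)%:R.
  by exists d => p q ps qs; apply: Hd.
move=> p; case: (boolP (p \in rays s)) => [ps|_]; last by exists 0.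
have [i pi] := HA p ps; exists (lat R (col i (invmx A))^T) => _ q qs.
have dualE k :
    pairing (lat R (col i (invmx A))^T) (lat R (row k A)) = (k == i)%:R.
  rewrite pairing_lat; have := congr1 (fun B : 'M_n => B k i) (mulmxV Au).
  rewrite !mxE -(rmorph_nat (intr : int -> R)) => <-; congr (_%:~R).
  by apply: eq_bigr => l _; rewrite !mxE mulrC.
case: (eqVneq p q) => [<-|pq]; first by rewrite /vgen -pi dualE eqxx.
have [j qj] := HA q qs; rewrite /vgen -qj dualE; case: eqVneq => // ji.
by case/eqP: pq; apply/(@vgen_inj _ _ S); rewrite /vgen -pi -qj ji.
Qed.

(* Junk if s is not smooth. *)
Definition dualv s : ray S -> 'rV[R]_n :=
  xget (fun=> 0) [set d : ray S -> 'rV[R]_n | forall p q,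
    p \in rays s -> q \in rays s ->
    pairing (d p) (vgen q) = (p == q)%:R]%classic.

(** The coordinate along the generator of [p] on the span of [s]; off that span the value depends on
    the choice of [dualv]. *)
Definition rcoef s p x : R := pairing (dualv s p) x.

Lemma rcoef_vgen s p q : p \in rays s -> q \in rays s ->
  rcoef s p (vgen q) = (p == q)%:R.
Proof.
rewrite /rcoef /dualv; case: xgetP => [d _|none]; first exact.
by have [d Hd] := exists_dual s; case: (none d).
Qed.

Lemma rcoefD s p x y : rcoef s p (x + y) = rcoef s p x + rcoef s p y.
Proof. exact: pairingDr. Qed.

Lemma rcoefZ s p c x : rcoef s p (c *: x) = c * rcoef s p x.
Proof. exact: pairingZr. Qed.

Lemma rcoefN s p x : rcoef s p (- x) = - rcoef s p x.
Proof. exact: pairingNr. Qed.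

Lemma rcoef_sum s q (A : {set ray S}) (c : ray S -> R) :
  A \subset rays s -> q \in rays s ->
  rcoef s q (\sum_(p in A) c p *: vgen p) = if q \in A then c q else 0.
Proof.
move=> /subsetP sA qs; rewrite /rcoef pairing_sumr.
have e p : p \in A -> pairing (dualv s q) (c p *: vgen p) = c p * (q == p)%:R.
  by move=> pA; rewrite pairingZr -/(rcoef s q _) rcoef_vgen // sA.
rewrite (eq_bigr _ e); case: ifPn => qA.
  rewrite (bigD1 q) //= eqxx mulr1 big1 ?addr0 // => p /andP[_ /negPf pq].
  by rewrite eq_sym pq mulr0.
rewrite big1 // => p pA; case: eqVneq => [qp|]; last by rewrite mulr0.
by rewrite qp pA in qA.
Qed.

(** The linear span of [s], encoded as the set of points recovered from their coordinates. *)
Definition inspan s x : bool := x == \sum_(p in rays s) rcoef s p x *: vgen p.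

Lemma inspan_sum s (A : {set ray S}) (c : ray S -> R) : A \subset rays s ->
  inspan s (\sum_(p in A) c p *: vgen p).
Proof.
move=> sA; apply/eqP; rewrite [RHS](bigID (mem A)) /= [X in _ + X]big1 ?addr0.
  rewrite [RHS](eq_bigl (mem A)); last first.
    move=> p /=; case: (boolP (p \in A)) => pA; rewrite ?andbF //.
    by rewrite (subsetP sA).
  by apply: eq_bigr => p pA; rewrite rcoef_sum // ?pA // (subsetP sA).
by move=> p /andP[ps /negPf pA]; rewrite rcoef_sum // pA scale0r.
Qed.

Lemma inspanD s x y : inspan s x -> inspan s y -> inspan s (x + y).
Proof.
move=> /eqP sx /eqP sy; apply/eqP; rewrite {1}sx {1}sy -big_split.
by apply: eq_bigr => p _; rewrite rcoefD scalerDl.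
Qed.

Lemma inspanZ s c x : inspan s x -> inspan s (c *: x).
Proof.
move=> /eqP sx; apply/eqP; rewrite {1}sx scaler_sumr.
by apply: eq_bigr => p _; rewrite rcoefZ scalerA.
Qed.

Lemma inspanN s x : inspan s x -> inspan s (- x).
Proof. by rewrite -scaleN1r; apply: inspanZ. Qed.

Lemma carrierE s x :
  carrier s x <-> inspan s x /\ forall p, p \in rays s -> 0 <= rcoef s p x.
Proof.
split=> [/(carrier_gen S_proj)[c c0 ->]|[/eqP sx c0]].
  split=> [|p ps]; first exact: inspan_sum.
  by rewrite rcoef_sum // ps.
by rewrite sx; apply: carrier_sum => // p; rewrite mem_rays => /asboolP.
Qed.

Lemma carrier_subP s t :
  (forall x, carrier s x -> carrier t x) <-> rays s \subset rays t.
Proof.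
split=> [st|/subsetP st x /(carrier_gen S_proj)[c c0 ->]].
  by apply/subsetP => p; rewrite !mem_rays => /asboolP vs; apply/asboolP/st.
by apply: carrier_sum => // p /st; rewrite mem_rays => /asboolP.
Qed.

Lemma rays_inj : injective (@rays R n S).
Proof.
move=> s t e; apply/carrier_inj/seteqP.
by split; apply/carrier_subP; rewrite e.
Qed.

(** The sum [w] of the dual vectors of the rays outside [A] is nonnegative on [s] and vanishes
    exactly on the face generated by [A]. *)
Lemma exists_subcone s (A : {set ray S}) : A \subset rays s ->
  exists t, rays t = A.
Proof.
move=> sA; pose w := \sum_(p in rays s :\: A) dualv s p.
have wE x : pairing w x = \sum_(p in rays s :\: A) rcoef s p x.
  exact: pairing_suml.
have w0 x : carrier s x -> 0 <= pairing w x.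
  move=> /carrierE[_ c0]; rewrite wE sumr_ge0 // => p /setDP[ps _].
  exact: c0.
have fF : is_face (carrier s `&` [set x | pairing w x = 0])%classic (carrier s).
  by exists w; split.
have [t tF] := carrier_face fF; exists t; apply/setP => q.
rewrite mem_rays tF; apply/asboolP/idP => [[qs /= wq]|qA].
  have qs' : q \in rays s by rewrite mem_rays; apply/asboolP.
  apply: contraT => qA; move: wq; rewrite wE (bigD1 q) ?in_setD ?qA //=.
  rewrite rcoef_vgen // eqxx big1 ?addr0 => [/eqP|p].
    by rewrite oner_eq0.
  by rewrite in_setD => /andP[/andP[_ ps] pq]; rewrite rcoef_vgen // (negPf pq).
have qs := subsetP sA _ qA.
split; first by move: qs; rewrite mem_rays => /asboolP.
rewrite /= wE big1 // => p /setDP[ps pA]; rewrite rcoef_vgen //.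
by case: eqVneq => // pq; rewrite pq qA in pA.
Qed.

Lemma cone_dim_rays s : cone_dim (carrier s) = #|rays s|.
Proof.
pose e (i : 'I_#|rays s|) : ray S := enum_val i.
pose X := [tuple vgen (e i) | i < #|rays s|].
have es i : e i \in rays s by apply: enum_valP.
have sumX (k : ray S -> R) :
    \sum_(p in rays s) k p *: vgen p = \sum_i k (e i) *: X`_i.
  rewrite [LHS]big_enum_val; apply: eq_bigr => i _.
  by rewrite -tnth_nth tnth_mktuple.
have fX : free X.
  apply/freeP => k k0 i; pose c p := \sum_(j | e j == p) k j.
  have ce j : c (e j) = k j.
    rewrite /c (eq_bigl (pred1 j)) ?big_pred1_eq // => l.
    by rewrite /e (inj_eq enum_val_inj).
  have := rcoef_sum c (subxx _) (es i); rewrite es ce => <-.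
  rewrite sumX; under eq_bigr do rewrite ce.
  by rewrite k0 /rcoef pairing0r.
rewrite /cone_dim (@lin_span_eq _ _ _ <<X>>%VS).
- by move/eqP: fX; rewrite size_tuple.
- move=> x /carrierE[/eqP -> _]; rewrite sumX; apply: memv_suml => i _.
  by apply/memvZ/memv_span/mem_nth; rewrite size_tuple.
- move=> W sW; apply/span_subvP => v /mapP[i _ ->]; apply: sW.
  by have := es i; rewrite mem_rays => /asboolP.
Qed.

Lemma card_rays_le s : (#|rays s| <= n)%N.
Proof.
rewrite -cone_dim_rays (leq_trans (dimvS (subvf _))) // dimvf /dim /=.
by rewrite mul1n.
Qed.

(** Expressed by numbers of rays, signed sums over faces of a cone become signed sums over
    subsets. *)
Lemma codim_sign s : (-1) ^+ codim s = (-1) ^+ n * (-1) ^+ #|rays s| :> R.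
Proof.
rewrite /codim cone_dim_rays; have := card_rays_le s; move: #|rays s| => k kn.
by rewrite -[in RHS](subnK kn) exprD -mulrA -expr2 sqrr_sign mulr1.
Qed.

Definition relint s x : Prop :=
  carrier s x /\ forall p, p \in rays s -> 0 < rcoef s p x.

(** The intersection is the face of [s] on which some [w], nonnegative on [s], vanishes. As [x] has
    positive coordinates, [w] vanishes at every generator of [s]. *)
Lemma relint_sub s t x : relint s x -> carrier t x -> rays s \subset rays t.
Proof.
move=> [xs cx] xt; have [[w [w0 Fw]] _] := carrier_inter s t.
have : (carrier s `&` carrier t)%classic x by [].
rewrite Fw => -[_ /= wx]; have [/eqP sx _] := (carrierE s x).1 xs.
apply/subsetP => p ps; have vs : carrier s (vgen p).
  by move: ps; rewrite mem_rays => /asboolP.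
suff wp : pairing w (vgen p) = 0.
  have : (carrier s `&` [set x | pairing w x = 0])%classic (vgen p) by [].
  by rewrite -Fw mem_rays => -[_ ?]; apply/asboolP.
move: wx; rewrite sx pairing_sumr => /eqP; rewrite psumr_eq0.
  move=> /allP/(_ p (mem_index_enum p)); rewrite ps pairingZr mulf_eq0.
  by rewrite gt_eqF ?cx //= => /eqP.
move=> q; rewrite mem_rays pairingZr => qs; apply: mulr_ge0.
  by apply/ltW/cx; rewrite mem_rays.
by apply: w0; apply/asboolP.
Qed.

Lemma relint_uniq s t x : relint s x -> relint t x -> s = t.
Proof.
move=> sx tx; apply: rays_inj; apply/eqP; rewrite eqEsubset.
by rewrite (relint_sub sx tx.1) (relint_sub tx sx.1).
Qed.

(** In any cone containing [x], the rays with positive coordinate generate the required face. *)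
Lemma exists_relint x : exists s, relint s x.
Proof.
have [t /carrierE[/eqP tx c0]] := carrier_cover S_proj x.
pose A := [set p in rays t | 0 < rcoef t p x].
have sA : A \subset rays t by apply/subsetP => p; rewrite inE => /andP[].
have [s rs] := exists_subcone sA; exists s.
have xA : x = \sum_(p in rays s) rcoef t p x *: vgen p.
  rewrite {1}tx rs (bigID (mem A)) /= [X in _ + X]big1 ?addr0.
    apply: eq_bigl => p /=; case: (boolP (p \in A)) => pA; rewrite ?andbF //.
    by rewrite (subsetP sA).
  move=> p /andP[ps]; rewrite inE ps /= lt_def c0 // andbT negbK => /eqP ->.
  by rewrite scale0r.
have cs p : p \in rays s -> 0 < rcoef s p x.
  by move=> ps; rewrite xA rcoef_sum // ps; move: ps; rewrite rs inE => /andP[].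
split=> //; apply/carrierE; split=> [|p /cs/ltW//].
by rewrite xA; apply: inspan_sum.
Qed.

Definition bary s : 'rV[R]_n := \sum_(p in rays s) vgen p.

Lemma rcoef_bary s t p : rays t \subset rays s -> p \in rays s ->
  rcoef s p (bary t) = (p \in rays t)%:R.
Proof.
move=> ts ps; have -> : bary t = \sum_(p in rays t) 1 *: vgen p.
  by apply: eq_bigr => q _; rewrite scale1r.
by rewrite rcoef_sum //; case: (p \in rays t).
Qed.

Lemma inspan_bary s t : rays t \subset rays s -> inspan s (bary t).
Proof.
move=> ts; have -> : bary t = \sum_(p in rays t) 1 *: vgen p.
  by apply: eq_bigr => q _; rewrite scale1r.
exact: inspan_sum.
Qed.

Lemma relint_bary s : relint s (bary s).
Proof.
have c p : p \in rays s -> 0 < rcoef s p (bary s).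
  by move=> ps; rewrite rcoef_bary // ps.
by split=> //; apply/carrierE; split=> [|p /c/ltW//]; apply: inspan_bary.
Qed.

(** The point [z] is [y + N *: bary t] with [N] large, up to scale a small displacement of [bary t]
    in direction [y]. A cone not containing [t] violates an inequality at [bary t], hence at [z]. *)
Lemma perturb t y : exists z, forall s,
  (rays t \subset rays s -> [/\ inspan s z = inspan s y,
     forall p, p \in rays t -> 0 < rcoef s p z &
     forall p, p \in rays s :\: rays t -> rcoef s p z = rcoef s p y]) /\
  (carrier s z -> rays t \subset rays s).
Proof.
suff /fin_all_exists[N HN] : forall s, exists N, 0 <= N /\ forall M, N <= M ->
    let z := y + M *: bary t in
    (rays t \subset rays s -> forall p, p \in rays t -> 0 < rcoef s p z) /\
    (carrier s z -> rays t \subset rays s).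
  (* The sum dominates each of the nonnegative thresholds [N s]. *)
  exists (y + (\sum_s N s) *: bary t) => s; have [_ H] := HN s.
  have [|pos sub] := H (\sum_s N s).
    rewrite (bigD1 s) //= lerDl sumr_ge0 // => s' _; by have [] := HN s'.
  split=> // ts; split; last 2 first.
  - exact: pos.
  - move=> p /setDP[ps /negPf pt].
    by rewrite rcoefD rcoefZ rcoef_bary // pt mulr0 addr0.
  apply/idP/idP => [sz|sy]; last first.
    by apply/inspanD/inspanZ/inspan_bary.
  rewrite -(addrK ((\sum_s N s) *: bary t) y).
  by apply/inspanD/inspanN/inspanZ/inspan_bary.
move=> s; case: (boolP (rays t \subset rays s)) => ts.
  have [N N0 HN] :=
    large_multiple (enum (rays t)) (fun=> 1) (fun p => rcoef s p y).
  exists N; split=> // M NM; split=> // _ p pt.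
  have ps := subsetP ts _ pt.
  rewrite rcoefD rcoefZ rcoef_bary // pt.
  by apply: HN; rewrite ?mem_enum.
have [L HL] := carrier_halfspaces S_proj s.
have [a aL na] : exists2 a, a \in L & pairing a (bary t) < 0.
  apply: contrapT => none; move/negP: ts; apply.
  apply: relint_sub (relint_bary t) _.
  apply/HL => a aL; rewrite leNgt; apply/negP => lt; apply: none.
  by exists a.
have [N N0 HN] := large_multiple [:: a]
  (fun a => - pairing a (bary t)) (fun a => - pairing a y).
exists N; split=> // M NM; split=> // /HL/(_ a aL).
have := HN M a NM (mem_head _ _); rewrite oppr_gt0 => /(_ na).
by rewrite mulrN -opprD oppr_gt0 pairingDr pairingZr ltNge => /negP.
Qed.

(* Moving from the relative interior of t in direction y, one enters the
   relative interior of s. *)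
Definition enters y t s : bool :=
  [&& rays t \subset rays s, inspan s y &
      [forall p in rays s :\: rays t, 0 < rcoef s p y]].

(** The cone [s0] is the one with the point [z] of [perturb] in its relative interior. *)
Lemma enters_uniq y t : exists s0, forall s, enters y t s = (s == s0).
Proof.
have [z Hz] := perturb t y; have [s0 rs0] := exists_relint z.
exists s0 => s; apply/idP/eqP => [/and3P[ts sy /forall_inP cy]|->].
  apply: (relint_uniq _ rs0); have [[//|sz pos eqc] _] := Hz s.
  have cs p : p \in rays s -> 0 < rcoef s p z.
    move=> ps; case: (boolP (p \in rays t)) => [/pos//|pt].
    by rewrite eqc ?cy // in_setD ps pt.
  by split=> //; apply/carrierE; rewrite sz; split=> // p /cs/ltW.
have [H1 ts] := Hz s0; have {}ts := ts rs0.1.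
have [sz pos eqc] := H1 ts; rewrite /enters ts -sz.
have [/carrierE[-> _] cz] := rs0.
by apply/forall_inP => p pst; rewrite -eqc // cz //; case/setDP: pst.
Qed.

(** With weak inequalities the condition says that [s] contains [z], hence the cone [s1] having [z]
    in its relative interior. *)
Lemma weakly_enters_above y t : exists s1, forall s,
  [&& rays t \subset rays s, inspan s y &
      [forall p in rays s :\: rays t, 0 <= rcoef s p y]] =
  (rays s1 \subset rays s).
Proof.
have [z Hz] := perturb t y; have [s1 rs1] := exists_relint z.
exists s1 => s; apply/idP/idP => [/and3P[ts sy /forall_inP cy]|s1s].
  apply: relint_sub rs1 _; have [[//|sz pos eqc] _] := Hz s.
  apply/carrierE; rewrite sz; split=> // p ps.
  case: (boolP (p \in rays t)) => [/pos/ltW//|pt].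
  by rewrite eqc ?cy // in_setD ps pt.
have zs : carrier s z by apply: (carrier_subP s1 s).2 rs1.1.
have [H1 ts] := Hz s; have {}ts := ts zs.
have [sz pos eqc] := H1 ts; rewrite ts -sz.
have [-> cz] := (carrierE s z).1 zs.
by apply/forall_inP => p pst; rewrite -eqc // cz //; case/setDP: pst.
Qed.

End SimplicialFan.

(** * The Euler relation *)

(** Toggling an element of [C] outside [B] is a sign-reversing involution of the interval, so the
    sum equals its opposite. *)
Lemma sum_sign_interval (R : numDomainType) (T : finType) (B C : {set T}) :
  B \subset C ->
  \sum_(A : {set T} | (B \subset A) && (A \subset C)) (-1) ^+ #|A| =
  if B == C then (-1) ^+ #|C| else 0 :> R.
Proof.
move=> BC; case: eqVneq => [->|neq].
  by rewrite (big_pred1 C) // => A; rewrite [RHS]eqEsubset andbC.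
have [x xC xB] : exists2 x, x \in C & x \notin B.
  by apply/subsetPn; apply: contra neq => CB; rewrite eqEsubset BC.
pose tog (A : {set T}) := if x \in A then A :\ x else x |: A.
have togK : involutive tog.
  move=> A; rewrite /tog; case: (boolP (x \in A)) => xA.
    by rewrite setD11 setD1K.
  by rewrite setU11 setU1K.
have togP A : (B \subset tog A) && (tog A \subset C) =
              (B \subset A) && (A \subset C).
  rewrite /tog; case: (boolP (x \in A)) => xA.
    rewrite subsetD1 xB andbT; congr (_ && _).
    by rewrite -{2}(setD1K xA) subUset sub1set xC.
  rewrite subUset sub1set xC; congr (_ && _).
  by rewrite -{2}(setU1K xA) subsetD1 xB andbT.
set sum := LHS; apply/eqP; rewrite -eqNr; apply/eqP.
rewrite /sum [RHS](reindex_inj (inv_inj togK)) /= -sumrN; apply: eq_big => A.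
  by rewrite togP.
move=> _; rewrite /tog; case: (boolP (x \in A)) => xA.
  by rewrite (cardsD1 x A) xA exprS mulN1r opprK.
by rewrite cardsU1 xA exprS mulN1r.
Qed.

Section Euler.
Variables (R : realType) (n : nat) (S : fan R n).
Hypotheses (S_smooth : smooth S) (S_proj : projective S).
Implicit Types (s t : S) (p q : ray S) (x y : 'rV[R]_n).

Let sgn s : R := (-1) ^+ codim s.

(** Faces of [s] correspond to subsets of its rays, which reduces this to [sum_sign_interval]. *)
Lemma sum_sign_between (B : {set ray S}) s : B \subset rays s ->
  \sum_(t | (B \subset rays t) && (rays t \subset rays s)) sgn t =
  if B == rays s then sgn s else 0.
Proof.
move=> Bs; rewrite /sgn.
under eq_bigr => t _ do rewrite (codim_sign S_smooth S_proj).
rewrite -mulr_sumr (codim_sign S_smooth S_proj).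
have := sum_sign_interval R Bs.
pose D := [set t : S | (B \subset rays t) && (rays t \subset rays s)].
rewrite (eq_bigl (mem [set rays t | t in D])).
  rewrite big_imset /=; last by move=> ? ? _ _; apply: rays_inj.
  rewrite (eq_bigl (fun t => (B \subset rays t) && (rays t \subset rays s))).
    by move=> ->; case: eqP => _; rewrite ?mulr0.
  by move=> t; rewrite inE.
move=> A /=; apply/idP/imsetP => [/andP[BA As]|[t + ->]]; last by rewrite inE.
have [t tA] := exists_subcone S_smooth S_proj As.
by exists t; rewrite ?inE tA ?BA.
Qed.

(* Each cone above t0 enters a unique s in direction y; grouping by s, only
   the s with nonpositive rcoefficients of y outside t0 survive. *)
Lemma sum_sign_star_move y t0 :
  \sum_(t | rays t0 \subset rays t) sgn t =
  \sum_(s | [&& rays t0 \subset rays s, inspan s (- y) &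
      [forall p in rays s :\: rays t0, 0 <= rcoef s p (- y)]]) sgn s.
Proof.
transitivity (\sum_(t | rays t0 \subset rays t) \sum_(s | enters y t s) sgn t).
  apply: eq_bigr => t _; have [s0 Hs0] := enters_uniq S_smooth S_proj y t.
  by rewrite (big_pred1 s0).
rewrite (exchange_big_dep predT) //= [RHS]big_mkcond; apply: eq_bigr => s _.
case: (boolP (rays t0 \subset rays s)) => /= t0s; last first.
  rewrite big1 // => t /andP[t0t /and3P[ts _ _]]; case/negP: t0s.
  exact: subset_trans ts.
case: (boolP (inspan s y)) => sy; last first.
  rewrite big1 => [|t /andP[_ /and3P[_]]]; last by rewrite (negPf sy).
  case: ifP => // /andP[/inspanN]; rewrite opprK => sy'.
  by rewrite sy' in sy.
rewrite (inspanN sy) /=.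
(* The cones above [t0] entering [s] are those whose rays lie between [B] and [rays s]. *)
pose B := rays t0 :|: [set p in rays s | rcoef s p y <= 0].
have Bs : B \subset rays s.
  by rewrite subUset t0s; apply/subsetP => p /setIdP[].
rewrite (eq_bigl (fun t => (B \subset rays t) && (rays t \subset rays s))).
  rewrite sum_sign_between //; congr (if _ then _ else _).
  apply/eqP/forall_inP => [BE p /setDP[ps pt0]|H].
    move: ps; rewrite -BE in_setU (negPf pt0) => /setIdP[_].
    by rewrite rcoefN oppr_ge0.
  apply/eqP; rewrite eqEsubset Bs; apply/subsetP => p ps.
  rewrite in_setU; case: (boolP (p \in rays t0)) => //= pt0.
  have := H p; rewrite in_setD ps pt0 rcoefN oppr_ge0 => /(_ isT) c0.
  by apply/setIdP.
move=> t; rewrite /enters sy /= subUset -!andbA; congr (_ && _).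
rewrite andbC; case: (boolP (rays t \subset rays s)) => ts;
  rewrite ?andbF ?andbT //=.
apply/forall_inP/subsetP => [H p /setIdP[ps]|H p /setDP[ps pt]].
  apply: contraLR => pt; rewrite -ltNge; apply: H; by rewrite in_setD ps pt.
by rewrite ltNge; apply: contra pt => c0; apply: H; apply/setIdP.
Qed.

Lemma sum_sign_star t : \sum_(s | rays t \subset rays s) sgn s = 1.
Proof.
have [k] := ubnP (#|{: ray S}| - #|rays t|)%N.
elim: k t => // k IH t le.
have [[y yt]|all_in] := pselect (exists y, ~~ inspan t y).
  rewrite (sum_sign_star_move (- y)) opprK.
  have [s1 Hs1] := weakly_enters_above S_smooth S_proj y t.
  rewrite (eq_bigl _ _ Hs1); apply: IH.
  have /and3P[ts1 s1y _] : [&& rays t \subset rays s1, inspan s1 y &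
      [forall p in rays s1 :\: rays t, 0 <= rcoef s1 p y]] by rewrite Hs1.
  (* The span of [s1] contains [y], that of [t] does not. *)
  have lt : (#|rays t| < #|rays s1|)%N.
    apply: proper_card; rewrite properE ts1; apply: contra yt => s1t.
    have -> // : t = s1.
    by apply: rays_inj => //; apply/eqP; rewrite eqEsubset ts1.
  by rewrite ltnS in le; apply: leq_trans le; rewrite ltn_sub2l //
    (leq_trans lt) // max_card.
have inn y : inspan t y.
  by apply: contrapT => ny; apply: all_in; exists y; apply/negP.
(* Here [t] is full-dimensional and no other cone contains it, so only its own sign 1 remains. *)
rewrite (big_pred1 t) => [|s].
  rewrite /sgn; suff -> : codim t = 0%N by [].
  have dimR : \dim {:'rV[R]_n} = n by rewrite dimvf /dim /= mul1n.
  apply/eqP; rewrite subn_eq0 -[leqLHS]dimR.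
  apply/dimvS/subvP => y _; have /eqP -> := inn y.
  rewrite /lin_span; case: xgetP => [V _ [tV _]|_]; last exact: memvf.
  apply: memv_suml => p pt; apply/memvZ/tV.
  by move: pt; rewrite mem_rays => /asboolP.
rewrite /=; apply/idP/eqP => [ts|->//]; apply: rays_inj => //.
apply/eqP; rewrite eqEsubset ts andbT; apply/subsetP => p ps.
have := inn (vgen p) => /eqP e.
(* If [p] were not a ray of [t], its generator, a combination of those of [t], would have
   [p]-coordinate 0 in [s] instead of 1. *)
have := rcoef_sum S_smooth (fun q => rcoef t q (vgen p)) ts ps.
rewrite -e (rcoef_vgen S_smooth) // eqxx; case: ifP => // _ /eqP.
by rewrite oner_eq0.
Qed.

Lemma exists_meet s t : exists m, rays m = rays s :&: rays t.
Proof. exact: exists_subcone (subsetIl _ _). Qed.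

(** The cones above [m], of total sign 1, are grouped by their intersection with [t]. For [m != t],
    induction gives 1 for the group of [t] and 0 for the other groups strictly above [m], leaving 0
    for [m]. *)
Lemma sum_sign_meet t m : rays m \subset rays t ->
  \sum_(s | rays s :&: rays t == rays m) sgn s = (m == t)%:R.
Proof.
have [k] := ubnP (#|rays t| - #|rays m|)%N.
elim: k m => // k IH m le mt.
have small m' : rays m \subset rays m' -> rays m' \subset rays t -> m' != m ->
    (#|rays t| - #|rays m'| < k)%N.
  move=> mm' m't neq; rewrite ltnS in le; apply: leq_trans le.
  have lt : (#|rays m| < #|rays m'|)%N.
    apply: proper_card; rewrite properE mm'; apply: contra neq => m'm.
    by apply/eqP/rays_inj => //; apply/eqP; rewrite eqEsubset m'm.
  by rewrite ltn_sub2l // (leq_trans lt) // subset_leq_card.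
have := sum_sign_star m.
have meets s : exists m', rays m' == rays s :&: rays t.
  by have [m' e] := exists_meet s t; exists m'; rewrite e.
have {meets}[meet meetE] : exists meet : S -> S, forall s,
    rays (meet s) = rays s :&: rays t.
  by have [f Hf] := fin_all_exists meets; exists f => s; apply/eqP.
rewrite (partition_big meet
  (fun m' => (rays m \subset rays m') && (rays m' \subset rays t))).
  have inner m' : (rays m \subset rays m') && (rays m' \subset rays t) ->
      \sum_(s | (rays m \subset rays s) && (meet s == m')) sgn s =
      \sum_(s | rays s :&: rays t == rays m') sgn s.
    move=> /andP[mm' _]; apply: eq_bigl => s.
    rewrite -(inj_eq (rays_inj S_proj)) meetE.
    case: eqP => [e|]; rewrite ?andbF // andbT.
    by apply: subset_trans mm' _; rewrite -e subsetIl.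
  rewrite (eq_bigr _ inner) (bigD1 m) ?subxx //=.
  case: (eqVneq m t) => [mt'|neq].
    rewrite [X in _ + X]big1 ?addr0 // => m' /andP[/andP[mm' m't] /eqP[]].
    by apply: rays_inj => //; apply/eqP; rewrite eqEsubset mm' mt' m't.
  rewrite [X in _ + X = _](bigD1 t) /=; last by rewrite mt subxx eq_sym.
  rewrite [X in _ + (_ + X)]big1 => [|m' /andP[/andP[/andP[mm' m't] m'm] m't']].
    rewrite addr0 (IH t) ?subxx ?eqxx //; last by rewrite small // eq_sym.
    by move=> /eqP; rewrite -subr_eq0 addrK => /eqP.
  by rewrite IH ?(negPf m't') // small.
by move=> s ms; rewrite meetE subsetIr subsetI ms mt.
Qed.

End Euler.

(** * The alternating sum *)

Section Assembly.
Variables (R : realType) (n : nat) (S : fan R n).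
Hypotheses (S_smooth : smooth S) (S_proj : projective S).
Implicit Types (s t : S) (p q : ray S) (x y : 'rV[R]_n).

Lemma pairing_carrier t x (w : 'rV[int]_n) : carrier t x ->
  pairing (lat R w) x =
  \sum_(p in rays t) rcoef t p x * (pairing w (prim_gen p))%:~R.
Proof.
move=> /(carrierE S_smooth S_proj)[/eqP tx _]; rewrite [in LHS]tx pairing_sumr.
by apply: eq_bigr => p _; rewrite pairingZr pairing_lat.
Qed.

(** All cones containing [x] have as a face the cone with [x] in its relative interior, and the sum
    only sees the characters restricted to it. *)
Lemma KclassE r (E : tvb S r) t x : carrier t x ->
  Kclass E x = \sum_(j < r) expR (pairing (lat R (tvb_char E t j)) x).
Proof.
move=> xt; rewrite /Kclass; case: pickP => [t' /asboolP xt'|none]; last first.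
  by have /asboolP := xt; rewrite none.
have [s rs] := exists_relint S_smooth S_proj x.
pose phi (v : {ffun ray S -> int}) :=
  expR (\sum_(p in rays s) rcoef s p x * (v p)%:~R).
have e t1 : \sum_(j < r) expR (pairing (lat R (tvb_char E t1 j)) x) =
    \sum_(j < r) phi (restr (rays s)
      (fun p => pairing (tvb_char E t1 j) (prim_gen p))).
  apply: eq_bigr => j _; rewrite /phi (pairing_carrier _ rs.1); congr expR.
  by apply: eq_bigr => p ps; rewrite ffunE ps.
rewrite !e; apply: sum_char_restr; exact: relint_sub rs _.
Qed.

Section Twisted.
Variables (r : nat) (E : tvb S r) (f : 'rV[R]_n -> R).
Variables (u : S -> S -> 'I_r -> 'rV[int]_n) (hu : twisted_chars E f u).
Variables (t : S) (x : 'rV[R]_n) (xt : carrier t x).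

Let twisted_sum s := \sum_(j < r) expR (pairing (lat R (u s t j)) x).

(** The exponential of a twisted character at [x], in a form where [s] enters only through a
    restriction to [A], as [sum_char_restr] requires. *)
Let phi (A : {set ray S}) (v : {ffun ray S -> int}) :=
  expR (\sum_(p in rays t) rcoef t p x *
    (if p \in A then (v p)%:~R else f (vgen p))).

Let twisted_sumE s (A : {set ray S}) : A = rays s :&: rays t ->
  twisted_sum s = \sum_(j < r) phi A (restr A
    (fun p => pairing (tvb_char E s j) (prim_gen p))).
Proof.
move=> eA; apply: eq_bigr => j _; rewrite (pairing_carrier _ xt); congr expR.
apply: eq_bigr => p pt; rewrite (hu s j pt) ffunE eA in_setI pt andbT.
by case: ifP.
Qed.

(** On the rays of [t] outside [m] both families take the values of [f]; on [m], a face of [s], the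
    multisets of restrictions agree. *)
Lemma twisted_sum_meet s m : rays m = rays s :&: rays t ->
  twisted_sum s = twisted_sum m.
Proof.
move=> rm; rewrite (twisted_sumE rm) (@twisted_sumE m (rays m)); last first.
  by rewrite rm -setIA setIid.
by apply: sum_char_restr; rewrite // rm subsetIl.
Qed.

Lemma twisted_sum_self :
  twisted_sum t = \sum_(j < r) expR (pairing (lat R (tvb_char E t j)) x).
Proof.
apply: eq_bigr => j _; rewrite !(pairing_carrier _ xt); congr expR.
by apply: eq_bigr => p pt; rewrite (hu t j pt) pt.
Qed.

Lemma sum_sign_twisted :
  \sum_s (-1) ^+ codim s * twisted_sum s = twisted_sum t.
Proof.
have meets s : exists m, rays m = rays s :&: rays t.
  exact: exists_meet S_smooth S_proj s t.
have [meet meetE] := fin_all_exists meets.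
rewrite (partition_big meet (fun m => rays m \subset rays t)); last first.
  by move=> s _; rewrite meetE subsetIr.
transitivity (\sum_(m | rays m \subset rays t) (m == t)%:R * twisted_sum m).
  apply: eq_bigr => m mt; rewrite -(sum_sign_meet S_smooth S_proj mt) mulr_suml.
  apply: eq_big => s.
    by rewrite -(inj_eq (rays_inj S_proj)) meetE.
  by move=> /eqP <-; rewrite (twisted_sum_meet (meetE s)).
rewrite (bigD1 t) //= eqxx mul1r big1 ?addr0 // => m /andP[_ /negPf ->].
by rewrite mul0r.
Qed.

Lemma Kclass_Fk k : Kclass (Fk hu k) x = \sum_(s | codim s == k) twisted_sum s.
Proof.
rewrite (KclassE _ xt) /=.
rewrite -(big_enum_val (fun a : {s : S | codim s == k} * 'I_r =>
  expR (pairing (lat R (u (val a.1) t a.2)) x))) /=.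
rewrite -(pair_bigA _ (fun (s : {s : S | codim s == k}) j =>
  expR (pairing (lat R (u (val s) t j)) x))) /=.
(* The sum over cones of codimension [k] is moved to the subtype, with [insub] as partial inverse of
   the inclusion. *)
rewrite [RHS](reindex_omap (val : {s : S | codim s == k} -> S) insub) /=.
  by apply: eq_bigl => s; rewrite valK eqxx (valP s).
by move=> s ks; rewrite insubT.
Qed.

Lemma sum_Kclass_Fk : \sum_s (-1) ^+ codim s * twisted_sum s =
  \sum_(k < n.+1) (-1) ^+ k * Kclass (Fk hu k) x.
Proof.
(* The bound makes codimensions elements of ['I_n.+1], by which the cones are grouped. *)
have cn s : (codim s < n.+1)%N by rewrite ltnS leq_subr.
rewrite (partition_big (fun s => Ordinal (cn s)) predT) //=.
apply: eq_bigr => k _; rewrite Kclass_Fk mulr_sumr.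
by apply: eq_big => [s|s /eqP <-] //; rewrite -val_eqE.
Qed.

End Twisted.
End Assembly.

Theorem theorem4p3 (R : realType) (n r : nat) (S : fan R n)
    (S_smooth : smooth S) (S_proj : projective S)
    (E : tvb S r) (f : 'rV[R]_n -> R)
    (f_pl : integral_pl S f)
    (f_bound : forall (p : ray S) (i : int),
       f (lat R (prim_gen p)) < i%:~R ->
       mrank (tvb_matroid E) (filt E p i) = 0%N)
    (u : S -> S -> 'I_r -> 'rV[int]_n) (hu : twisted_chars E f u)
    (t : S) (x : 'rV[R]_n) (xt : carrier t x) :
  Kclass E x =
    \sum_(s : S) (-1) ^+ codim s *
      \sum_(j < r) expR (pairing (lat R (u s t j)) x)
  /\
  \sum_(s : S) (-1) ^+ codim s *
      \sum_(j < r) expR (pairing (lat R (u s t j)) x) =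
    \sum_(k < n.+1) (-1) ^+ k * Kclass (Fk hu k) x.
Proof.
split; last exact: sum_Kclass_Fk.
rewrite (sum_sign_twisted S_smooth S_proj hu xt).
rewrite (twisted_sum_self S_smooth S_proj hu xt).
by rewrite (KclassE S_smooth S_proj E xt).
Qed.
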